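(* Let $(K,\nu_0)$ be a valued field with $\mathrm{char}(K)=p>0$ and value group $\Gamma_0$. Let $F(x)=x^p-x-a\in K[x]$ be an irreducible Artin–Schreier polynomial and $L=K[x]/(F)$. Assume that $\nu_0$ is a rank one valuation. Then the following hold. (i) There exists $b\in K$ such that $\nu_0(F(b))>0$ if and only if there exist $p$ many distinct extensions of $\nu_0$ to $L$. (ii) Assume that $\nu_0(F(b))\leq 0$ for every $b\in K$. Set $$S:=\left\{\frac{\nu_0(F(b))}{p}\ \Big|\ b\in K\right\}\subseteq\frac1p\Gamma_0.$$ Fix an extension $\nu$ of $\nu_0$ to $L$ and let $e$ and $f$ be the ramification index and the inertia degree of $(L|K,\nu)$, respectively. Then: - If $S\not\subseteq\Gamma_0$, then $e=p$. - If $S\subseteq\Gamma_0$ and $S$ has a maximum, then $f=p$. - If $S\subseteq\Gamma_0$ and $S$ does not have a maximum, then $\nu$ is the unique extension of $\nu_0$ to $L$ and $e=f=1$. In particular, $$d:=\frac{[L:K]}{ef}=p.$$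
   Context: Extensions of $\nu_0$ to $L$ are taken with values in $\Gamma\cup\{\infty\}$, where $\Gamma$ is a fixed totally ordered divisible abelian group containing $\Gamma_0$ (so $\frac1p\Gamma_0\subseteq\Gamma$), and they restrict to $\nu_0$ on $K$. The ramification index is $e=(\nu L:\nu_0K)$, the index of value groups, and the inertia degree is $f=[L\nu:K\nu_0]$, the degree of the residue field extension. *)

(* Defs.v *)
From HB Require Import structures.
From mathcomp Require Import all_boot all_order all_algebra all_field.
From mathcomp Require Import finmap.
From mathcomp Require Import boolp classical_sets functions cardinality.

Set Implicit Arguments.
Unset Strict Implicit.
Unset Printing Implicit Defensive.

Import Order.TTheory GRing.Theory Num.Theory.

Local Open Scope classical_set_scope.
Local Open Scope ring_scope.
Local Open Scope quotient_scope.

HB.mixin Record isOrderedAb G of Num.POrderedZmodule G := {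
  oab_total : total (<=%R : rel G);
  oab_leD2r : forall z x y : G, x <= y -> x + z <= y + z
}.

#[short(type="orderedAbType")]
HB.structure Definition OrderedAb :=
  {G of isOrderedAb G & Num.POrderedZmodule G}.

Definition divisible (G : zmodType) : Prop :=
  forall (n : nat) (g : G), (0 < n)%N -> exists h : G, h *+ n = g.

(* [option G] stands for $\Gamma\cup\{\infty\}$, with [None] as infinity. *)
Section ExtendedGroup.
Variable G : orderedAbType.
Implicit Types u v : option G.

Definition vle u v : bool :=
  match u, v with
  | _, None => true
  | None, Some _ => false
  | Some g, Some h => g <= h
  end.

Definition vlt u v : bool :=
  match u, v with
  | None, _ => false
  | Some _, None => true
  | Some g, Some h => g < h
  end.

Definition vmin u v : option G := if vle u v then u else v.

Definition vadd u v : option G :=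
  match u, v with
  | Some g, Some h => Some (g + h)
  | _, _ => None
  end.

End ExtendedGroup.

Record valuation (F : fieldType) (G : orderedAbType) := Valuation {
  val_fun :> F -> option G;
  val_eqoo : forall x, val_fun x = None <-> x = 0;
  valM : forall x y, val_fun (x * y) = vadd (val_fun x) (val_fun y);
  val_leD : forall x y, vle (vmin (val_fun x) (val_fun y)) (val_fun (x + y))
}.

Lemma valuationP (F : fieldType) (G : orderedAbType) (nu nu' : valuation F G) :
  nu =1 nu' -> nu = nu'.
Proof.
case: nu nu' => [f f1 f2 f3] [g g1 g2 g3] /= /funext fg; case: g / fg g1 g2 g3.
by move=> g1 g2 g3; congr Valuation; exact: Prop_irrelevance.
Qed.

Section ValueGroup.
Variables (F : fieldType) (G : orderedAbType).

Definition value_group (nu : valuation F G) : set G :=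
  [set g | exists x, nu x = Some g].

Definition subgroup (H : set G) : Prop :=
  H 0 /\ forall g h, H g -> H h -> H (g - h).

Definition convex_subgroup (A H : set G) : Prop :=
  [/\ subgroup H, H `<=` A
    & forall g h, A g -> H h -> 0 <= g <= h -> H g].

Definition rank_one (nu : valuation F G) : Prop :=
  value_group nu <> [set 0] /\
  forall H, convex_subgroup (value_group nu) H ->
    H = [set 0] \/ H = value_group nu.

End ValueGroup.

Definition cosets (G : zmodType) (A B : set G) : set (set G) :=
  [set C | exists2 g, A g & C = [set g + h | h in B]].

(* 0 when the index is infinite *)
Definition group_index (G : zmodType) (A B : set G) : nat :=
  #|` fset_set (cosets A B)|%fset.

Section ValuationTheory.
Variables (F : fieldType) (G : orderedAbType) (nu : valuation F G).

Lemma oab_addr_ge0 (g h : G) : 0 <= g -> 0 <= h -> 0 <= g + h.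
Proof. by move=> g0 /(oab_leD2r g); rewrite add0r addrC; exact: le_trans. Qed.

Lemma oab_double0 (g : G) : g + g = 0 -> g = 0.
Proof.
move=> gg; case/orP: (oab_total 0 g) => h; apply/eqP; rewrite eq_le h ?andbT /=.
- by move: (oab_leD2r g _ _ h); rewrite add0r gg.
- by move: (oab_leD2r g _ _ h); rewrite add0r gg.
Qed.

Lemma val0 : nu 0 = None. Proof. exact/val_eqoo. Qed.

Lemma val_Some x : x != 0 -> exists g, nu x = Some g.
Proof.
move=> x0; case E: (nu x) => [g|]; first by exists g.
by move/val_eqoo: E x0 => ->; rewrite eqxx.
Qed.

Lemma val1 : nu 1 = Some 0.
Proof.
have [g E] := val_Some (oner_neq0 F); have := valM nu 1 1.
rewrite mulr1 E => -[] /eqP; rewrite eq_sym -subr_eq0 addrK => /eqP ->; done.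
Qed.

Lemma valN1 : nu (-1) = Some 0.
Proof.
have [|g E] := @val_Some (-1); first by rewrite oppr_eq0 oner_neq0.
have := valM nu (-1) (-1); rewrite mulrNN mulr1 val1 E => -[] /esym.
by move/oab_double0 ->.
Qed.

Lemma valV x g : nu x = Some g -> nu x^-1 = Some (- g).
Proof.
move=> E; have x0 : x != 0.
  by apply: contra_eqN E => /eqP ->; rewrite val0.
have [h E'] := val_Some (invr_neq0 x0); rewrite E'; congr Some.
have := valM nu x x^-1; rewrite divff // val1 E E' => -[] /esym /eqP.
by rewrite addrC addr_eq0 => /eqP.
Qed.

End ValuationTheory.

Section ResidueField.
Variables (F : fieldType) (G : orderedAbType) (nu : valuation F G).

Definition val_ring : {pred F} := fun x => vle (Some 0) (nu x).

Lemma val_ring_subring : subring_closed val_ring.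
Proof.
rewrite /val_ring; split; first by rewrite unfold_in val1 /=.
- move=> x y; rewrite !unfold_in => x0 y0.
  have := val_leD nu x (- y); rewrite -mulN1r (valM nu (-1) y) valN1.
  case: (nu x) (nu y) (nu (x + _)) x0 y0 => [g|] [h|] [k|] //=;
    rewrite /vmin /= ?add0r; try by case: ifP.
  + by move=> g0 h0; case: ifP => /= _; apply: le_trans.
  + by move=> g0 _; exact: le_trans.
  + by move=> _ h0; exact: le_trans.
- move=> x y; rewrite !unfold_in valM.
  by case: (nu x) (nu y) => [g|] [h|] //=; exact: oab_addr_ge0.
Qed.

HB.instance Definition _ :=
  GRing.isSubringClosed.Build F val_ring val_ring_subring.

Record vring := VRing { vring_val :> F; _ : vring_val \in val_ring }.

HB.instance Definition _ := [isSub for vring_val].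
HB.instance Definition _ := [Choice of vring by <:].
HB.instance Definition _ := [SubChoice_isSubComNzRing of vring by <:].

Definition max_ideal : {pred vring} := fun x => vlt (Some 0) (nu (val x)).

Lemma max_ideal_closed : idealr_closed max_ideal.
Proof.
rewrite /max_ideal; split; rewrite ?unfold_in /= ?val0 ?val1 //= ?ltxx //.
have pos (c g : G) : 0 <= c -> 0 < g -> 0 < c + g.
  by move=> /(oab_leD2r g); rewrite add0r => cg g0; exact: lt_le_trans cg.
move=> [a a0] [x x0] [y y0]; rewrite !unfold_in /= => hx hy.
have := val_leD nu (a * x) y; move: a0 hx hy.
rewrite valM /in_mem /= /val_ring /vmin.
case: (nu a) (nu x) (nu y) (nu (a * x + y)) => [c|] [g|] [h|] [k|] //=.
+ by move=> c0 g0 h0; case: ifP => /= _; apply: lt_le_trans; rewrite ?pos.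
+ by move=> c0 g0 _; apply: lt_le_trans; rewrite pos.
+ by move=> _ _ h0; exact: lt_le_trans.
+ by move=> _ _ h0; exact: lt_le_trans.
+ by move=> _ _ h0; exact: lt_le_trans.
Qed.

HB.instance Definition _ := isIdealr.Build vring max_ideal max_ideal_closed.

Definition residue := {ideal_quot max_ideal}.

HB.instance Definition _ := GRing.ComNzRing.on residue.

(* Reduction map; elements outside of the valuation ring are sent to 0. *)
Definition reduce (x : F) : residue := \pi_residue (insubd (0 : vring) x).

Definition residue_repr (u : residue) : F := val (repr u).

Lemma residue_repr_ring u : residue_repr u \in val_ring.
Proof. exact: valP. Qed.

Lemma residue_reprK : cancel residue_repr reduce.
Proof. by move=> u; rewrite /reduce /residue_repr valKd reprK. Qed.

Lemma reduce_eq x y : x \in val_ring -> y \in val_ring ->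
  (reduce x == reduce y) = vlt (Some 0) (nu (x - y)).
Proof.
move=> xO yO; rewrite /reduce -Quotient.idealrBE unfold_in /max_ideal /=.
by rewrite !insubdK.
Qed.

Lemma reduce0 : reduce 0 = 0.
Proof.
rewrite /reduce (_ : insubd _ _ = 0) ?rmorph0 //.
by apply: val_inj; rewrite insubdK // rpred0.
Qed.

Lemma reduce1 : reduce 1 = 1.
Proof.
rewrite /reduce (_ : insubd _ _ = 1) ?rmorph1 //.
by apply: val_inj; rewrite insubdK // rpred1.
Qed.

Lemma reduceM x y : x \in val_ring -> y \in val_ring ->
  reduce (x * y) = reduce x * reduce y.
Proof.
move=> xO yO; rewrite /reduce -rmorphM; congr (\pi _).
by apply: val_inj; rewrite /= !insubdK // rpredM.
Qed.

Lemma reduceD x y : x \in val_ring -> y \in val_ring ->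
  reduce (x + y) = reduce x + reduce y.
Proof.
move=> xO yO; rewrite /reduce -rmorphD; congr (\pi _).
by apply: val_inj; rewrite /= !insubdK // rpredD.
Qed.

Definition residue_inv (u : residue) : residue :=
  if u == 0 then 0 else reduce (residue_repr u)^-1.

Lemma residue_mulVf u : u != 0 -> residue_inv u * u = 1.
Proof.
rewrite /residue_inv => u0; rewrite (negbTE u0).
rewrite -{2}[u]residue_reprK; set x := residue_repr u.
have xO : x \in val_ring by exact: residue_repr_ring.
have : ~~ vlt (Some 0) (nu (x - 0)).
  by rewrite -reduce_eq ?rpred0 // reduce0 residue_reprK.
rewrite subr0; case E: (nu x) => [g|] //= g0.
have x0 : x != 0 by apply: contra_eqN E => /eqP ->; rewrite val0.
rewrite -reduceM ?mulVf ?reduce1 // unfold_in /val_ring (valV E) /=.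
have g_le0 : g <= 0.
  by case/orP: (oab_total g 0) => //; rewrite le_eqVlt (negbTE g0) orbF => /eqP->.
by have := oab_leD2r (- g) _ _ g_le0; rewrite subrr add0r.
Qed.

Lemma residue_inv0 : residue_inv 0 = 0.
Proof. by rewrite /residue_inv eqxx. Qed.

HB.instance Definition _ :=
  GRing.ComNzRing_isField.Build residue residue_mulVf residue_inv0.

End ResidueField.

(* Degree of F over the subfield phi(E); 0 when it is infinite. *)
Definition ext_degree (E F : fieldType) (phi : E -> F) : nat :=
  xget 0%N [set n | exists b : 'I_n -> F, forall y : F,
    exists! c : {ffun 'I_n -> E}, y = \sum_i phi (c i) * b i].

Section Extensions.
Variables (K : fieldType) (L : fieldExtType K) (G : orderedAbType).
Variables (nu0 : valuation K G) (nu : valuation L G).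

Definition extends : Prop := forall x : K, nu x%:A = nu0 x.

Definition ramification_index : nat :=
  group_index (value_group nu) (value_group nu0).

Definition residue_map (u : residue nu0) : residue nu :=
  reduce nu (residue_repr u)%:A.

(* When nu extends nu0, residue_map is the canonical embedding. *)
Lemma residue_map_reduce x : extends -> x \in val_ring nu0 ->
  residue_map (reduce nu0 x) = reduce nu x%:A.
Proof.
move=> ext xO; set y := residue_repr (reduce nu0 x).
have yO : y \in val_ring nu0 by exact: residue_repr_ring.
have algO z : z \in val_ring nu0 -> z%:A \in val_ring nu.
  by rewrite !unfold_in /val_ring ext.
apply/eqP; rewrite reduce_eq ?algO // -scalerBl ext -reduce_eq //.
by rewrite residue_reprK.
Qed.

Definition inertia_degree : nat := ext_degree residue_map.

End Extensions.

Section ArtinSchreier.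
Variables (K : fieldType) (p : nat).

Definition artin_schreier (a : K) : {poly K} := 'X^p - 'X - a%:P.

Lemma artin_schreier_monic (a : K) :
  p \in [pchar K] -> artin_schreier a \is monic.
Proof.
move=> /pcharf_prime /prime_gt1 p1; rewrite /artin_schreier -addrA -opprD.
rewrite monicE lead_coefDl ?lead_coefXn // size_polyXn size_polyN.
by rewrite size_XaddC ltnS.
Qed.

Lemma artin_schreier_mi (a : K) :
  p \in [pchar K] -> irreducible_poly (artin_schreier a) ->
  monic_irreducible_poly (artin_schreier a).
Proof. by move=> pK irr; split=> //; exact: artin_schreier_monic. Qed.

Definition artin_schreier_ext (a : K) (pK : p \in [pchar K])
    (irr : irreducible_poly (artin_schreier a)) : fieldExtType K :=
  {poly %/ (artin_schreier a) with (artin_schreier_mi pK irr)}.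

End ArtinSchreier.

(* Main.v *)
Require Import Defs.
From HB Require Import structures.
From mathcomp Require Import all_boot all_order all_algebra all_field.
From mathcomp Require Import boolp classical_sets functions cardinality.

Import Order.TTheory GRing.Theory Num.Theory.
Import Defs.

(** Write [theta] for the class of [X] in [L], so that
    [(theta - b)^p - (theta - b) = - F(b)] for every [b] in [K].  This equation
    ties the distance from [theta] to [b] to the value of [F(b)]: for every
    extension [nu], if [nu0 (F b) = p s] with [s <= 0] then
    [nu (theta - b) = s], whatever [nu] is ([val_theta_sub]).  When no [F(b)] has
    positive value, [S] is therefore the set of distances from [theta] to [K].

    Suppose first that [c = F(b)] has positive value.  The partial sums
    [x_n = b + c + c^p + ... + c^(p^(n-1))] satisfy [F(x_n) = c^(p^n)], which
    tends to 0 because a rank one value group is archimedean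
    ([rank_one_archimedean]).  For [g] prime to [F] a Bezout relation shows that
    [nu0 (g(x_n))] is eventually constant ([horner_stable]), and the eventual
    value of [nu0 (g(x_n))] defines an extension with [nu (theta - b) > 0]
    ([limit_valuation]); it is the only such extension because [x_n] tends to
    [theta] for any of them ([limit_unique]).  Replacing [b] by [b + j], [j < p],
    does not change [F(b)] and gives [p] extensions.  They are distinct, and they
    are all of them: the product of the [theta - b - j] is [- F(b)], so some
    factor has positive value ([split_card]).

    Suppose now that all [nu0 (F b)] are at most 0.  In each of the three cases
    below the values of an extension on all of [L] are determined by [nu0]
    alone; hence there is at most one extension ([nonpositive_uniq]), and never
    [p] of them.

    - If [s] in [S] lies outside the value group, realized at [b], then [s] has
      order [p] modulo that group, so the terms of [sum_(i < p) c_i (theta - b)^i]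
      have distinct values and the value of the sum is their minimum
      ([monomial_val_distinct]).  This gives [e = p].
    - If [S] lies in the value group and has maximum [m], realized at [b], take
      [d] in [K] of value [m], and [d = 1] if [m = 0].  By maximality the residue [rho] of
      [(theta - b) / d] is not in the residue field of [K], while it is a root of
      [X^p - X - u] (if [m = 0]) or of [X^p - u] (if [m < 0]).  The roots of
      these polynomials are translates of [rho] by residues of [K], which forces
      [rho] to have degree [p] ([translate_roots_indep]).  So the powers of
      [rho] are a basis of the residue extension, and [f = p].
    - If [S] lies in the value group and has no maximum, the elements [b] of [K]
      ordered by their distance to [theta] form a pseudo-Cauchy family.  For
      every nonzero [g] of degree less than [p], the value of
      [g(theta) - g(b)] exceeds that of [g(theta)] once [b] is close enough to
      [theta] ([approximates_all]).  If a [g] of least degree failed this, [nu0 (g(b))]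
      would grow like [beta + r gamma(b)] with [gamma(b) = nu (theta - b)] and
      [1 <= r]; expanding [F] in base [g] and comparing with
      [nu0 (F b) = p gamma(b)] yields [i r = p] with [i deg g <= p] and
      [r <= deg g < p]; as [p] is prime, [r = 1] and [g] is linear, for which the
      claim is clear.  Hence every nonzero element of [L] differs from some
      element of [K] by an element of larger value, so [e = f = 1]. *)

Local Open Scope classical_set_scope.
Local Open Scope ring_scope.

Set Implicit Arguments.
Unset Strict Implicit.
Unset Printing Implicit Defensive.

(** * Ordered abelian groups and valuations *)

Section OrderedGroup.
Variable G : orderedAbType.
Implicit Types (g h k : G) (u v w : option G).

Lemma oab_leD2 k g h : (g + k <= h + k) = (g <= h).
Proof.
by apply/idP/idP => [/(oab_leD2r (- k))|/(oab_leD2r k)//]; rewrite !addrK.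
Qed.

Lemma oab_ltD2 k g h : (g + k < h + k) = (g < h).
Proof. by rewrite !lt_def oab_leD2 (inj_eq (addIr k)). Qed.

Lemma oab_ltNge g h : (g < h) = ~~ (h <= g).
Proof.
rewrite lt_def; case/orP: (oab_total h g) => hg; rewrite hg /=.
  by apply: contraTF isT => /andP[hn gh]; rewrite eq_le hg gh in hn.
apply/idP/idP => [/andP[hn _]|nhg]; first by apply: contra hn => gh; rewrite eq_le gh hg.
by rewrite andbT; apply: contra nhg => /eqP ->.
Qed.

Lemma oab_leD g h g' h' : g <= g' -> h <= h' -> g + h <= g' + h'.
Proof.
move=> gg hh; apply: (@le_trans _ _ (g' + h)); first by rewrite oab_leD2.
by rewrite ![g' + _]addrC oab_leD2.
Qed.

Lemma oab_lt_leD g h g' h' : g < g' -> h <= h' -> g + h < g' + h'.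
Proof.
move=> gg hh; apply: (@lt_le_trans _ _ (g' + h)); first by rewrite oab_ltD2.
by rewrite ![g' + _]addrC oab_leD2.
Qed.

Lemma oab_leMn n g h : g <= h -> g *+ n <= h *+ n.
Proof.
by move=> gh; elim: n => [|n IH]; rewrite ?mulr0n // !mulrS oab_leD.
Qed.

Lemma oab_ltMn n g h : (0 < n)%N -> g < h -> g *+ n < h *+ n.
Proof.
by case: n => // n _ gh; rewrite !mulrS oab_lt_leD ?oab_leMn // ltW.
Qed.

Lemma oab_leMnE n g h : (0 < n)%N -> (g *+ n <= h *+ n) = (g <= h).
Proof.
move=> n0; apply/idP/idP => [|/(oab_leMn n)//].
by apply: contraTT; rewrite -!oab_ltNge; exact: oab_ltMn.
Qed.

Lemma oab_mulIn n : (0 < n)%N -> injective (fun g => g *+ n).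
Proof.
by move=> n0 g h /eqP; rewrite eq_le !oab_leMnE // -eq_le => /eqP.
Qed.

Lemma oab_leN0 g : (- g <= 0) = (0 <= g).
Proof. by rewrite -[LHS](oab_leD2 g) addNr add0r. Qed.

Lemma oab_subr_ge0 g h : (0 <= h - g) = (g <= h).
Proof. by rewrite -[LHS](oab_leD2 g) add0r subrK. Qed.

Lemma oab_subr_gt0 g h : (0 < h - g) = (g < h).
Proof. by rewrite -[LHS](oab_ltD2 g) add0r subrK. Qed.

Lemma oab_leMn_exp m n g : 0 <= g -> (m <= n)%N -> g *+ m <= g *+ n.
Proof.
move=> g0 /subnK <-; rewrite mulrnDr -{1}[g *+ m]add0r oab_leD2.
by rewrite -(mul0rn _ (n - m)) oab_leMn.
Qed.

Lemma vle_refl u : vle u u.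
Proof. by case: u => /=. Qed.

Lemma vltNge u v : vlt u v = ~~ vle v u.
Proof. by case: u v => [g|] [h|] //=; rewrite oab_ltNge. Qed.

Lemma vleNgt u v : vle u v = ~~ vlt v u.
Proof. by rewrite vltNge negbK. Qed.

Lemma vle_trans v u w : vle u v -> vle v w -> vle u w.
Proof. by case: u v w => [g|] [h|] [k|] //=; exact: le_trans. Qed.

Lemma vlt_le_trans v u w : vlt u v -> vle v w -> vlt u w.
Proof. by case: u v w => [g|] [h|] [k|] //=; exact: lt_le_trans. Qed.

Lemma vle_lt_trans v u w : vle u v -> vlt v w -> vlt u w.
Proof. by case: u v w => [g|] [h|] [k|] //=; exact: le_lt_trans. Qed.

Lemma vltW u v : vlt u v -> vle u v.
Proof. by case: u v => [g|] [h|] //=; exact: ltW. Qed.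

Lemma vle_total u v : vle u v || vle v u.
Proof. by case: u v => [g|] [h|] //=; exact: oab_total. Qed.

Lemma vle_anti u v : vle u v -> vle v u -> u = v.
Proof.
by case: u v => [g|] [h|] //= gh hg; congr Some; apply/eqP; rewrite eq_le gh hg.
Qed.

Lemma vle_vmin u v w : vle w (vmin u v) = vle w u && vle w v.
Proof.
rewrite /vmin; case: ifP => uv.
  by rewrite andb_idr // => wu; exact: vle_trans uv.
rewrite andb_idl // => wv; apply: vle_trans wv _.
by move: (vle_total u v); rewrite uv.
Qed.

Lemma vlt_vmin u v w : vlt w (vmin u v) = vlt w u && vlt w v.
Proof.
rewrite /vmin; case: ifP => uv.
  by rewrite andb_idr // => wu; exact: vlt_le_trans uv.
rewrite andb_idl // => wv; apply: vlt_le_trans wv _.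
by move: (vle_total u v); rewrite uv.
Qed.

Lemma vle_add u v u' v' : vle u u' -> vle v v' -> vle (vadd u v) (vadd u' v').
Proof.
by case: u v u' v' => [g|] [h|] [g'|] [h'|] //=; exact: oab_leD.
Qed.

End OrderedGroup.

Section ValuationBasics.
Variables (F : fieldType) (G : orderedAbType) (nu : valuation F G).
Implicit Types (x y : F) (u w : option G).

Lemma valN x : nu (- x) = nu x.
Proof. by rewrite -mulN1r valM valN1; case: (nu x) => //= g; rewrite add0r. Qed.

Lemma val_leadd w x y : vle w (nu x) -> vle w (nu y) -> vle w (nu (x + y)).
Proof.
by move=> wx wy; apply: vle_trans (val_leD nu x y); rewrite vle_vmin wx.
Qed.

Lemma val_ltadd w x y : vlt w (nu x) -> vlt w (nu y) -> vlt w (nu (x + y)).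
Proof.
by move=> wx wy; apply: vlt_le_trans (val_leD nu x y); rewrite vlt_vmin wx.
Qed.

(** The ultrametric inequality applied to [x = (x + y) - y] excludes that
    [x + y] has larger value than [x]. *)
Lemma val_addl x y : vlt (nu x) (nu y) -> nu (x + y) = nu x.
Proof.
move=> xy; apply: vle_anti; last by rewrite val_leadd ?vle_refl // vltW.
rewrite vleNgt; apply/negP => lt; move: xy; rewrite -(valN y) => xy.
by move: (val_ltadd lt xy); rewrite addrK vltNge vle_refl.
Qed.

Lemma val_addr x y : vlt (nu y) (nu x) -> nu (x + y) = nu y.
Proof. by rewrite addrC; exact: val_addl. Qed.

Lemma val_sum_lt I (r : seq I) (P : pred I) (t : I -> F) g :
  (forall i, P i -> vlt (Some g) (nu (t i))) ->
  vlt (Some g) (nu (\sum_(i <- r | P i) t i)).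
Proof.
move=> wt; apply: (big_ind (fun x => vlt (Some g) (nu x))) => // [|x y].
  by rewrite val0.
exact: val_ltadd.
Qed.

Lemma valX x g n : nu x = Some g -> nu (x ^+ n) = Some (g *+ n).
Proof.
move=> xg; elim: n => [|n IH]; first by rewrite expr0 val1 mulr0n.
by rewrite exprS valM xg IH /= mulrS.
Qed.

Lemma valX0 x n : vle (Some 0) (nu x) -> vle (Some 0) (nu (x ^+ n)).
Proof.
move=> x0; elim: n => [|n IH]; first by rewrite expr0 val1 vle_refl.
by rewrite exprS valM; move: (vle_add x0 IH); rewrite /= addr0.
Qed.

Lemma val_neq0 x g : nu x = Some g -> x != 0.
Proof. by move=> xg; apply: contra_eqN xg => /eqP ->; rewrite val0. Qed.

Lemma val_div x y g h : nu x = Some g -> nu y = Some h -> nu (x / y) = Some (g - h).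
Proof. by move=> xg yh; rewrite valM xg (valV yh). Qed.

End ValuationBasics.

(** * Evaluation of polynomials and Artin-Schreier roots *)

Section Evaluation.
Variables (K : fieldType) (L : fieldExtType K).
Implicit Types (g h : {poly K}) (b c : K) (x : L).

Lemma in_alg_horner g b :
  (g.[b])%:A = (map_poly (in_alg L) g).[b%:A] :> L.
Proof. exact/esym/(horner_map (in_alg L)). Qed.

Lemma horner_alg_comp g h x :
  horner_alg x (g \Po h) = horner_alg (horner_alg x h) g.
Proof.
by rewrite /horner_alg /horner_morph map_comp_poly horner_comp.
Qed.

Lemma horner_alg_coef g n x : (size g <= n)%N ->
  horner_alg x g = \sum_(i < n) g`_i *: x ^+ i.
Proof.
move=> gn; rewrite /horner_alg /horner_morph (@horner_coef_wide _ n) ?size_map_poly //.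
by apply: eq_bigr => i _; rewrite coef_map /= mulr_algl.
Qed.

(** Otherwise a Bezout relation between [F] and [g], evaluated at [x], would
    read [0 = 1]. *)
Lemma irreducible_root_dvdp (F g : {poly K}) x : irreducible_poly F ->
  horner_alg x F = 0 -> (horner_alg x g == 0) = (F %| g).
Proof.
move=> irrF Fx; apply/idP/idP => [/eqP gx|/dvdpP[h ->]]; last first.
  by rewrite rmorphM /= Fx mulr0.
apply: contraT; rewrite -irreducible_poly_coprime // => /Bezout_eq1_coprimepP.
move=> [[u v] /= uv]; have := congr1 (horner_alg x) uv.
by rewrite rmorphD !rmorphM /= Fx gx !mulr0 add0r rmorph1 => /esym/eqP; rewrite oner_eq0.
Qed.

End Evaluation.

Section ArtinSchreierRoots.
Variables (k : fieldType) (p : nat) (pk : p \in [pchar k]).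
Implicit Types (a x y rho : k).

Let p_pr : prime p := pcharf_prime pk.
Let p_gt0 : (0 < p)%N := prime_gt0 p_pr.

Lemma exprBp x y : (x - y) ^+ p = x ^+ p - y ^+ p.
Proof. by rewrite -!(pFrobenius_autE pk) pFrobenius_autB_comm //; apply: mulrC. Qed.

Lemma exprDp x y : (x + y) ^+ p = x ^+ p + y ^+ p.
Proof. by rewrite -!(pFrobenius_autE pk) pFrobenius_autD_comm //; apply: mulrC. Qed.

Lemma natr_expp n : (n%:R : k) ^+ p = n%:R.
Proof. by rewrite -(pFrobenius_autE pk) pFrobenius_aut_nat. Qed.

Lemma natr_inj_ltp i j : (i < p)%N -> (j < p)%N -> (i%:R : k) = j%:R -> i = j.
Proof.
wlog ij : i j / (i <= j)%N => [hw ip jp eij|ip jp].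
  by case/orP: (leq_total i j) => h; [|symmetry]; apply: hw.
move=> /eqP; rewrite eq_sym -subr_eq0 -natrB // -(dvdn_pcharf pk) => dv.
apply/eqP; rewrite eqn_leq ij -subn_eq0 /=; apply: contraTT dv => n0.
by rewrite gtnNdvd ?lt0n // (leq_ltn_trans (leq_subr _ _)).
Qed.

Lemma horner_artin_schreier a x : (artin_schreier p a).[x] = x ^+ p - x - a.
Proof. by rewrite /artin_schreier !hornerE. Qed.

Lemma size_artin_schreier a : size (artin_schreier p a) = p.+1.
Proof.
rewrite /artin_schreier -addrA -opprD size_polyDl ?size_polyXn //.
by rewrite size_polyN size_XaddC ltnS prime_gt1.
Qed.

Lemma artin_schreier_prod rho :
  artin_schreier p (rho ^+ p - rho) =
    \prod_(r <- [seq rho + j%:R | j <- iota 0 p]) ('X - r%:P).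
Proof.
have mon : artin_schreier p (rho ^+ p - rho) \is monic by exact: artin_schreier_monic.
rewrite [LHS](all_roots_prod_XsubC (rs := [seq rho + j%:R | j <- iota 0 p])).
- by rewrite (eqP mon) scale1r.
- by rewrite size_artin_schreier size_map size_iota.
- apply/allP => _ /mapP[j _ ->]; rewrite rootE horner_artin_schreier exprDp.
  by rewrite natr_expp subr_eq0 opprD addrACA subrr addr0.
rewrite uniq_rootsE map_inj_in_uniq ?iota_uniq // => i j.
by rewrite !mem_iota => ip jp /addrI; exact: natr_inj_ltp.
Qed.

(** The inseparable analogue of [artin_schreier_prod], in the same shape: the
    translates of [rho] are [p] copies of [rho] itself. *)
Lemma expp_prod rho :
  'X^p - (rho ^+ p)%:P = \prod_(r <- nseq p rho) ('X - r%:P) :> {poly k}.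
Proof.
rewrite big_nseq -[LHS]/(_ - _) iter_mulr mulr1 polyC_exp.
have pP : p \in [pchar {poly k}] by rewrite pchar_poly.
by rewrite -!(pFrobenius_autE pP) -pFrobenius_autB_comm //; apply: mulrC.
Qed.

End ArtinSchreierRoots.

(** A nonzero [h] of degree less than [p] vanishing at [rho] shares with [P] a
    factor [q] of degree [d] with [0 < d < p].  The [d] roots of [q] are of the
    form [rho + phi u], so their sum is [d rho + phi v]; being a coefficient of
    [q] up to scaling, it lies in the image of [phi].  As [d] is invertible,
    [rho] would lie in the image too. *)
Lemma translate_roots_indep (k0 k : fieldType) (phi : {rmorphism k0 -> k})
    (P : {poly k0}) (rs : seq k) (rho : k) :
  size rs \in [pchar k] ->
  map_poly phi P = \prod_(r <- rs) ('X - r%:P) ->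
  {in rs, forall r, exists u, r = rho + phi u} ->
  rho \in rs -> (forall u, rho <> phi u) ->
  forall h : {poly k0}, h != 0 -> (size h <= size rs)%N ->
    (map_poly phi h).[rho] != 0.
Proof.
set p := size rs => pk Prs tr rho_rs rho_phi h h0 hp; apply/negP => hrho.
have Prho : root (map_poly phi P) rho by rewrite Prs root_prod_XsubC.
pose q := gcdp h P.
have qrho : root (map_poly phi q) rho by rewrite gcdp_map root_gcd Prho rootE hrho.
have q0 : q != 0 by rewrite gcdp_eq0 negb_and h0.
have q_gt1 : (1 < size q)%N.
  by rewrite -(size_map_poly phi); apply: root_size_gt1 qrho; rewrite map_poly_eq0.
have q_le : (size q <= p)%N by rewrite (leq_trans _ hp) // dvdp_leq ?dvdp_gcdl.
have : map_poly phi q %| \prod_(r <- rs) ('X - r%:P).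
  by rewrite -Prs dvdp_map dvdp_gcdr.
move=> /dvdp_prod_XsubC[m]; set ms := mask m rs => /eqpP[[c1 c2] /= /andP[c10 c20] eqq].
have size_ms : size q = (size ms).+1.
  by rewrite -(size_map_poly phi) -(size_scale _ c10) eqq size_scale // size_prod_XsubC.
have ms_gt0 : (0 < size ms)%N by rewrite -ltnS -size_ms.
have sum_ms s : {subset s <= rs} -> exists u, \sum_(r <- s) r = rho *+ size s + phi u.
  elim: s => [|r s IH] sub; first by exists 0; rewrite big_nil rmorph0 addr0.
  have [u eu] := IH (fun x xs => sub x (mem_behead (s := r :: s) xs)).
  have [v ev] := tr r (sub r (mem_head r s)).
  by exists (v + u); rewrite big_cons eu {1}ev addrACA rmorphD mulrS.
have [u eu] := sum_ms ms (mem_subseq (mask_subseq m rs)).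
(* The two top coefficients of [q], compared with those of the product. *)
have lead : c1 * phi q`_(size ms) = c2.
  move: (congr1 (fun f : {poly k} => f`_(size ms)) eqq) => /=.
  rewrite !coefZ coef_map /= => ->.
  have := monicP (monic_prod_XsubC ms predT id).
  by rewrite lead_coefE size_prod_XsubC /= => ->; rewrite mulr1.
have next : c1 * phi q`_(size ms).-1 = - c2 * (rho *+ size ms + phi u).
  move: (congr1 (fun f : {poly k} => f`_(size ms).-1) eqq) => /=.
  by rewrite !coefZ coef_map /= => ->; rewrite coefPn_prod_XsubC -?lt0n // eu mulNr mulrN.
have d0 : (size ms)%:R != 0 :> k0.
  rewrite -(fmorph_eq0 phi) rmorph_nat -(dvdn_pcharf pk) gtnNdvd //.
  by rewrite -size_ms.
have qd0 : q`_(size ms) != 0.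
  by have := lead_coef_eq0 q; rewrite lead_coefE size_ms /= => ->.
apply: (rho_phi ((- q`_(size ms).-1 / q`_(size ms) - u) / (size ms)%:R)).
have phid : (size ms)%:R != 0 :> k by rewrite -(rmorph_nat phi) fmorph_eq0.
have phiq : phi q`_(size ms) != 0 by rewrite fmorph_eq0.
apply: (mulIf phid); rewrite rmorphM fmorphV rmorph_nat divfK //.
rewrite rmorphB rmorphM rmorphN fmorphV /= mulr_natr.
apply: (addIr (phi u)); rewrite subrK; apply: (mulIf phiq); rewrite divfK //.
apply: (mulfI c10); rewrite mulrN next -lead !mulNr opprK.
by rewrite mulrA [LHS]mulrAC mulrC.
Qed.

(** * Degrees and residue field extensions *)

Section Degree.
Variables (E F : fieldType) (phi : {rmorphism E -> F}).

Definition is_basis n (b : 'I_n -> F) :=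
  forall y : F, exists! c : {ffun 'I_n -> E}, y = \sum_i phi (c i) * b i.

(** The matrices expressing [b] in [b'] and [b'] in [b] have product the
    identity of size [n], by uniqueness of coordinates in [b]; such a product
    factors through dimension [m]. *)
Lemma is_basis_leq n m (b : 'I_n -> F) (b' : 'I_m -> F) :
  is_basis b -> is_basis b' -> (n <= m)%N.
Proof.
move=> bb bb'.
have [A HA] := choice (fun j : 'I_n => bb' (b j)).
have [B HB] := choice (fun i : 'I_m => bb (b' i)).
pose MA := \matrix_(j < n, i < m) A j i; pose MB := \matrix_(i < m, k < n) B i k.
suff MAB : MA *m MB = 1%:M by exact: mulmx1_min MAB.
have [C HC] := choice (fun j : 'I_n => bb (b j)).
have rowE (j : 'I_n) (c : {ffun 'I_n -> E}) : b j = \sum_i phi (c i) * b i -> C j = c.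
  by move=> e; case: (HC j) => _; apply.
apply/matrixP => j k; rewrite !mxE.
transitivity (C j k).
  rewrite (rowE j [ffun k => \sum_i MA j i * MB i k]) ?ffunE //.
  transitivity (\sum_i \sum_k phi (A j i) * (phi (B i k) * b k)).
    rewrite [LHS](HA j).1; apply: eq_bigr => i _.
    by rewrite [b' i](HB i).1 big_distrr.
  rewrite exchange_big /=; apply: eq_bigr => l _.
  rewrite ffunE rmorph_sum big_distrl /=; apply: eq_bigr => i _.
  by rewrite rmorphM mulrA !mxE.
rewrite (rowE j [ffun k => (j == k)%:R]) ?ffunE //.
rewrite (bigD1 j) //= ffunE eqxx rmorph1 mul1r big1 ?addr0 // => i ij.
by rewrite ffunE eq_sym (negbTE ij) rmorph0 mul0r.
Qed.

Lemma ext_degree_basis n (b : 'I_n -> F) : is_basis b -> ext_degree phi = n.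
Proof.
move=> bb; apply: xget_subset1 => /=; first by exists b.
move=> i j [bi Hi] [bj Hj]; apply/eqP.
by rewrite eqn_leq (is_basis_leq Hi Hj) (is_basis_leq Hj Hi).
Qed.

End Degree.

Section ResidueMorphism.
Variables (K : fieldType) (L : fieldExtType K) (G : orderedAbType).
Variables (nu0 : valuation K G) (nu : valuation L G).

Lemma reduce_sum (I : Type) (r : seq I) (t : I -> L) :
  (forall i, t i \in val_ring nu) ->
  reduce nu (\sum_(i <- r) t i) = \sum_(i <- r) reduce nu (t i).
Proof.
move=> tO; elim: r => [|i r IH]; first by rewrite !big_nil reduce0.
by rewrite !big_cons reduceD ?IH // rpred_sum.
Qed.

Lemma reduceX x n : x \in val_ring nu -> reduce nu (x ^+ n) = reduce nu x ^+ n.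
Proof.
move=> xO; elim: n => [|n IH]; first by rewrite !expr0 reduce1.
by rewrite !exprS reduceM ?rpredX // IH.
Qed.

Hypothesis ext : extends nu0 nu.

(** The proof that [nu] extends [nu0] is an argument so that the ring morphism
    structure, which depends on it, can be attached to the function. *)
Definition residue_hom of extends nu0 nu : residue nu0 -> residue nu :=
  @residue_map K L G nu0 nu.

Lemma alg_val_ring x : (x%:A \in val_ring nu) = (x \in val_ring nu0).
Proof. by rewrite !unfold_in /val_ring ext. Qed.

Lemma residue_hom_zmod : zmod_morphism (residue_hom ext).
Proof.
move=> u v; rewrite -[u]residue_reprK -[v]residue_reprK /residue_hom.
set x := residue_repr u; set y := residue_repr v.
have xO : x \in val_ring nu0 by exact: residue_repr_ring.
have yO : y \in val_ring nu0 by exact: residue_repr_ring.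
have NyO : - y \in val_ring nu0 by rewrite rpredN.
have redN : - reduce nu0 y = reduce nu0 (- y).
  by apply/eqP; rewrite eq_sym -addr_eq0 -reduceD // addNr reduce0.
have redN' : - reduce nu y%:A = reduce nu (- y)%:A.
  apply/eqP; rewrite eq_sym -addr_eq0 -reduceD ?alg_val_ring //.
  by rewrite -scalerDl addNr scale0r reduce0.
rewrite redN -reduceD // !residue_map_reduce ?rpredD //.
by rewrite scalerDl reduceD ?alg_val_ring // redN'.
Qed.

Lemma residue_hom_monoid : monoid_morphism (residue_hom ext).
Proof.
split.
  rewrite -(reduce1 nu0) /residue_hom residue_map_reduce ?rpred1 //.
  by rewrite scale1r reduce1.
move=> u v; rewrite -[u]residue_reprK -[v]residue_reprK /residue_hom.
set x := residue_repr u; set y := residue_repr v.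
have xO : x \in val_ring nu0 by exact: residue_repr_ring.
have yO : y \in val_ring nu0 by exact: residue_repr_ring.
rewrite -reduceM // !residue_map_reduce ?rpredM //.
by rewrite -reduceM ?alg_val_ring // -scalerAl mul1r scalerA.
Qed.

HB.instance Definition _ := GRing.isZmodMorphism.Build
  (residue nu0) (residue nu) (residue_hom ext) residue_hom_zmod.
HB.instance Definition _ := GRing.isMonoidMorphism.Build
  (residue nu0) (residue nu) (residue_hom ext) residue_hom_monoid.

Lemma pchar_residue p : p \in [pchar K] -> p \in [pchar residue nu].
Proof.
move=> pK; rewrite inE (pcharf_prime pK) /=; apply/eqP.
have natE n : (n%:R : residue nu) = reduce nu n%:R.
  elim: n => [|n IH]; first by rewrite reduce0.
  by rewrite -!natr1 reduceD ?rpred_nat ?rpred1 // reduce1 IH.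
by rewrite natE -(mulr1n (1 : L)) -mulrnA mul1n -scaler_nat (pcharf0 pK) scale0r reduce0.
Qed.

End ResidueMorphism.

(** * Bases of monomials on which a valuation is a minimum *)

Lemma vargmin (G : orderedAbType) (t : nat -> option G) n : (0 < n)%N ->
  exists2 i0, (i0 < n)%N & forall i, (i < n)%N -> vle (t i0) (t i).
Proof.
case: n => // n _; elim: n => [|n [i0 i0n min]].
  by exists 0%N => // -[|i] // _; rewrite vle_refl.
case/orP: (vle_total (t i0) (t n.+1)) => h.
  exists i0; first by rewrite ltnW.
  by move=> i; rewrite ltnS leq_eqVlt => /orP[/eqP ->|] //; exact: min.
exists n.+1 => // i; rewrite ltnS leq_eqVlt => /orP[/eqP ->|]; first exact: vle_refl.
by move=> /min; exact: vle_trans.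
Qed.

Section ValueGroupTheory.
Variables (F : fieldType) (G : orderedAbType) (nu : valuation F G).
Let Gamma := value_group nu.

Lemma value_group0 : Gamma 0. Proof. by exists 1; exact: val1. Qed.

Lemma value_groupB g h : Gamma g -> Gamma h -> Gamma (g - h).
Proof. by move=> [x xg] [y yh]; exists (x / y); exact: val_div. Qed.

Lemma value_groupN g : Gamma g -> Gamma (- g).
Proof. by rewrite -sub0r; exact: value_groupB value_group0. Qed.

Lemma value_groupD g h : Gamma g -> Gamma h -> Gamma (g + h).
Proof.
move=> gG hG; rewrite -[h]opprK; apply: value_groupB => //.
exact: value_groupN.
Qed.

Lemma value_groupMn g n : Gamma g -> Gamma (g *+ n).
Proof. by move=> [x xg]; exists (x ^+ n); exact: valX. Qed.

(** The class of [s] modulo the value group has order exactly [p]: a Bezout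
    relation between [p] and [j - i] would express [s] through [p s] and
    [(j - i) s]. *)
Lemma value_group_prime_index p s i j : prime p -> Gamma (s *+ p) -> ~ Gamma s ->
  (i < p)%N -> (j < p)%N -> Gamma (s *+ i - s *+ j) -> i = j.
Proof.
move=> p_pr sp sn; wlog ij : i j / (i <= j)%N => [hw ip jp sij|ip jp].
  case/orP: (leq_total i j) => h; [|symmetry]; apply: hw => //.
  by rewrite -opprB; exact: value_groupN.
move=> /value_groupN; rewrite opprB -mulrnBr // => sn'.
apply/eqP; rewrite eqn_leq ij -subn_eq0 /= -leqn0 leqNgt; apply/negP => n0.
apply: sn; have : coprime (j - i) p.
  rewrite coprime_sym prime_coprime // gtnNdvd //.
  exact: leq_ltn_trans (leq_subr _ _) jp.
have [u v uv _] := egcdnP p n0; move=> /eqP cop; rewrite cop in uv.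
have -> : s = s *+ (j - i) *+ u - s *+ p *+ v.
  by rewrite -!mulrnA [(_ * u)%N]mulnC uv mulrnDr mulnC mulr1n addrAC subrr add0r.
by apply: value_groupB; apply: value_groupMn.
Qed.

(** This serves both for index [p], with [s] of order [p], and for index 1, with
    [s = 0]. *)
Lemma group_index_cyclic (B : set G) s n : B 0 ->
  (forall g h, B g -> B h -> B (g - h)) ->
  (forall i j, (i < n)%N -> (j < n)%N -> B (s *+ i - s *+ j) -> i = j) ->
  (forall g, Gamma g <-> exists2 i, (i < n)%N & B (g - s *+ i)) ->
  group_index Gamma B = n.
Proof.
move=> B0 BB inj GB; apply: card_fset_set.
pose coset g := [set g + h | h in B].
have BN h : B h -> B (- h) by rewrite -sub0r; apply: BB.
have BD g h : B g -> B h -> B (g + h).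
  by move=> gB hB; rewrite -[h]opprK; apply: BB => //; exact: BN.
have cosetE g h : B (g - h) -> coset g = coset h.
  move=> gh; apply/seteqP; split=> _ [k kB <-].
    by exists (g - h + k); [exact: BD | rewrite addrA addrC subrKC addrC].
  exists (k - (g - h)); first exact: BB.
  by rewrite opprB addrCA [g + _]addrC subrK addrC.
rewrite (_ : cosets _ _ = (fun i => coset (s *+ i)) @` `I_n); last first.
  apply/seteqP; split=> [C [g /GB[i i_n gi] ->]|_ [i /= i_n <-]].
    by exists i => //; exact/esym/cosetE.
  by exists (s *+ i) => //; apply/GB; exists i; rewrite ?subrr.
apply: inj_card_eq => i j /set_mem /= i_n /set_mem /= j_n eqc; apply: inj => //.
have : coset (s *+ i) (s *+ i) by exists 0; rewrite ?addr0.
by rewrite eqc => -[h hB <-]; rewrite addrAC subrr add0r.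
Qed.

End ValueGroupTheory.

Section MonomialBasis.
Variables (K : fieldType) (L : fieldExtType K) (G : orderedAbType).
Variables (nu0 : valuation K G) (p : nat) (eta : L) (s : G).
Implicit Types (nu : valuation L G) (h : {poly K}).

(** The value of [sum_i c_i eta^i] is the minimum of the [nu0 c_i + i s].  The
    minimum is expressed as a lower bound that is attained, so that two
    valuations with this property agree by antisymmetry. *)
Definition monomial_val nu := forall h, (size h <= p)%N ->
  exists2 i0, (i0 < p)%N &
    nu (horner_alg eta h) = vadd (nu0 h`_i0) (Some (s *+ i0)) /\
    forall i, (i < p)%N ->
      vle (nu (horner_alg eta h)) (vadd (nu0 h`_i) (Some (s *+ i))).

Lemma monomial_val_uniq nu nu' :
  (forall x : L, exists2 h : {poly K}, (size h <= p)%N & x = horner_alg eta h) ->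
  monomial_val nu -> monomial_val nu' -> nu = nu'.
Proof.
move=> gen mn mn'; apply: valuationP => x; have [h hp ->] := gen x.
have [i ip [ei mi]] := mn h hp; have [j jp [ej mj]] := mn' h hp.
by apply: vle_anti; [rewrite ej; exact: mi | rewrite ei; exact: mj].
Qed.

Variable nu : valuation L G.
Hypotheses (ext : extends nu0 nu) (p_gt0 : (0 < p)%N) (nu_eta : nu eta = Some s).

Lemma val_monomial c i : nu (c *: eta ^+ i) = vadd (nu0 c) (Some (s *+ i)).
Proof. by rewrite -mulr_algl valM ext (valX i nu_eta). Qed.

(** Nonzero terms [c_i eta^i] have pairwise distinct values, since two equal
    values would put [s i - s j] in the value group of [nu0]; a sum of terms with
    distinct values has the value of its smallest term. *)
Lemma monomial_val_distinct :
  (forall i j, (i < p)%N -> (j < p)%N ->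
    value_group nu0 (s *+ i - s *+ j) -> i = j) ->
  monomial_val nu.
Proof.
move=> inj h hp.
have [i0 i0p min] := vargmin (fun i => vadd (nu0 h`_i) (Some (s *+ i))) p_gt0.
exists i0 => //; suff -> : nu (horner_alg eta h) = vadd (nu0 h`_i0) (Some (s *+ i0)) by [].
rewrite (horner_alg_coef _ hp) (bigD1 (Ordinal i0p)) //= -val_monomial.
(* If the least value is infinite, all terms vanish. *)
case E : (nu (h`_i0 *: eta ^+ i0)) => [w|]; last first.
  move/val_eqoo: (E) => ->; rewrite add0r big1 ?val0 // => i _; apply/(val_eqoo nu).
  move: (min i (ltn_ord i)); rewrite -!val_monomial E.
  by case: (nu (_ *: _)).
rewrite val_addl ?E //; apply: val_sum_lt => i ne.
have := min i (ltn_ord i); rewrite -!val_monomial E.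
case E' : (nu (h`_i *: eta ^+ i)) => [w'|] //=.
rewrite le_eqVlt => /orP[/eqP ww|//]; move: E E'; rewrite -ww !val_monomial.
case Ei0 : (nu0 h`_i0) => [g0|] //= [g0w]; case Ei : (nu0 h`_i) => [g|] //= [gw].
case/eqP: ne; apply: val_inj; apply: inj => //=.
have -> : s *+ i - s *+ i0 = g0 - g.
  by apply: (addrI g); rewrite addrA gw -g0w addrK addrC subrK.
by apply: value_groupB; [exists h`_i0 | exists h`_i].
Qed.

End MonomialBasis.

Section ResidualBasis.
Variables (K : fieldType) (L : fieldExtType K) (G : orderedAbType).
Variables (nu0 : valuation K G) (nu : valuation L G) (p : nat) (eta : L).
Hypotheses (ext : extends nu0 nu) (p_gt0 : (0 < p)%N) (nu_eta : nu eta = Some 0).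
Let phi : {rmorphism residue nu0 -> residue nu} := residue_hom ext.
Let rho := reduce nu eta.

Hypothesis indep : forall h : {poly residue nu0}, h != 0 -> (size h <= p)%N ->
  (map_poly phi h).[rho] != 0.

Lemma eta_ring : eta \in val_ring nu.
Proof. by rewrite unfold_in /val_ring nu_eta /=. Qed.

Lemma reduce_horner (h : {poly K}) : (size h <= p)%N ->
  (forall i, h`_i \in val_ring nu0) ->
  reduce nu (horner_alg eta h) =
    \sum_(i < p) phi (reduce nu0 h`_i) * rho ^+ i.
Proof.
move=> hp hO; rewrite (horner_alg_coef _ hp) reduce_sum.
  apply: eq_bigr => i _.
  rewrite -mulr_algl reduceM ?(alg_val_ring ext) ?rpredX ?eta_ring //.
  by rewrite reduceX ?eta_ring // -(residue_map_reduce ext).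
move=> i; rewrite -mulr_algl rpredM ?(alg_val_ring ext) ?rpredX //; exact: eta_ring.
Qed.

Lemma indep_sum (c : 'I_p -> residue nu0) :
  \sum_(i < p) phi (c i) * rho ^+ i = 0 -> forall i, c i = 0.
Proof.
move=> c0 i; pose h := \poly_(j < p) (if insub j is Some j' then c j' else 0).
have hE (j : 'I_p) : h`_j = c j by rewrite coef_poly ltn_ord valK.
have [h0|h0] := eqVneq h 0; first by rewrite -hE h0 coef0.
have := indep h0 (size_poly _ _).
rewrite (@horner_coef_wide _ p) ?size_map_poly ?size_poly //.
rewrite -[X in _ != X]c0; under eq_bigr => j _ do [rewrite coef_map /= hE].
by rewrite eqxx.
Qed.

(** Dividing by a coefficient of least value gives coefficients in the valuation
    ring, one of them being 1; the residue of the sum is then a nontrivial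
    combination of powers of [rho], hence nonzero. *)
Lemma monomial_val_residual : monomial_val nu0 p eta 0 nu.
Proof.
move=> h hp; have [i0 i0p min] := vargmin (fun i => nu0 h`_i) p_gt0.
have vadd0 (u : option G) i : vadd u (Some (0 *+ i)) = u.
  by case: u => //= g; rewrite mul0rn addr0.
exists i0 => //; rewrite vadd0.
suff -> : nu (horner_alg eta h) = nu0 h`_i0.
  by split=> // i ip; rewrite vadd0; exact: min.
case E: (nu0 h`_i0) => [g|]; last first.
  rewrite (_ : h = 0) ?rmorph0 ?val0 //; apply/polyP => i; rewrite coef0.
  have [ip|ip] := ltnP i p; last by rewrite nth_default // (leq_trans hp).
  by apply/(val_eqoo nu0); move: (min i ip); rewrite E; case: (nu0 _).
set c := h`_i0 in E; have c0 : c != 0 := val_neq0 E.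
pose h' := c^-1 *: h.
have h'O i : h'`_i \in val_ring nu0.
  rewrite coefZ unfold_in /val_ring valM (valV E).
  have [ip|ip] := ltnP i p; last by rewrite nth_default ?val0 // (leq_trans hp).
  move: (min i ip); rewrite E; case: (nu0 h`_i) => //= k gk.
  by rewrite addrC oab_subr_ge0.
have hE : horner_alg eta h = c *: horner_alg eta h'.
  by rewrite linearZ /= mulr_algl scalerA divff // scale1r.
have h'p : (size h' <= p)%N by rewrite (leq_trans (size_scale_leq _ _)).
suff h'0 : nu (horner_alg eta h') = Some 0.
  by rewrite hE -mulr_algl valM ext E h'0 /= addr0.
have zO : horner_alg eta h' \in val_ring nu.
  rewrite (horner_alg_coef _ h'p) rpred_sum // => i _.
  by rewrite -mulr_algl rpredM ?(alg_val_ring ext) // rpredX // eta_ring.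
apply: vle_anti; last exact: zO.
rewrite vleNgt; apply/negP => z_gt0.
have /eqP : reduce nu (horner_alg eta h') == reduce nu 0.
  by rewrite reduce_eq ?rpred0 // subr0.
rewrite reduce0 reduce_horner // => /indep_sum/(_ (Ordinal i0p)) /= /eqP.
by rewrite -(reduce0 nu0) reduce_eq ?rpred0 // subr0 coefZ mulVf // val1 /= ltxx.
Qed.

Lemma residual_basis_degree :
  (forall x : L, exists2 h : {poly K}, (size h <= p)%N & x = horner_alg eta h) ->
  inertia_degree nu0 nu = p.
Proof.
move=> gen; apply: (@ext_degree_basis _ _ phi p (fun i => rho ^+ i)) => y.
have [h hp yh] := gen (residue_repr y).
have hO i : h`_i \in val_ring nu0.
  have [i0 i0p [_ /(_ i)]] := monomial_val_residual hp.
  have [ip /(_ isT)|ip _] := ltnP i p; last first.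
    by rewrite nth_default ?rpred0 // (leq_trans hp).
  rewrite -yh unfold_in /val_ring; have := residue_repr_ring y; rewrite unfold_in.
  by move=> y0 /(vle_trans y0); case: (nu0 _) => //= k; rewrite mul0rn addr0.
exists [ffun i : 'I_p => reduce nu0 h`_i]; split=> [|c yc].
  rewrite -[LHS]residue_reprK yh reduce_horner //.
  by apply: eq_bigr => i _; rewrite ffunE.
apply/ffunP => i; rewrite ffunE; apply/eqP; rewrite -subr_eq0; apply/eqP.
apply: (indep_sum (c := fun i => reduce nu0 h`_i - c i)).
under eq_bigr => j _ do rewrite rmorphB mulrBl.
by rewrite sumrB -yc -reduce_horner // -yh residue_reprK subrr.
Qed.

End ResidualBasis.

(** * Pseudo-Cauchy families and immediate extensions *)

Section Growth.
Variables (G : orderedAbType) (T : Type) (gamma : T -> G).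
Hypothesis no_max : forall b, exists b', gamma b < gamma b'.

(** The filter on [T] whose sets contain all [b] with [gamma b] large enough. *)
Definition tail (P : T -> Prop) := exists b0, forall b, gamma b0 <= gamma b -> P b.

Lemma tail_imp (P Q : T -> Prop) : (forall b, P b -> Q b) -> tail P -> tail Q.
Proof. by move=> PQ [b0 Pb]; exists b0 => b /Pb /PQ. Qed.

Lemma tail_and (P Q : T -> Prop) : tail P -> tail Q -> tail (fun b => P b /\ Q b).
Proof.
move=> [b0 Pb] [b1 Qb]; case/orP: (oab_total (gamma b0) (gamma b1)) => h.
  by exists b1 => b hb; split; [apply/Pb/(le_trans h) | exact: Qb].
by exists b0 => b hb; split; [exact: Pb | apply/Qb/(le_trans h)].
Qed.

Lemma tail_ex (P : T -> Prop) : tail P -> exists b, P b.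
Proof. by move=> [b0 Pb]; exists b0; exact: Pb. Qed.

Lemma tail_strict b0 : tail (fun b => gamma b0 < gamma b).
Proof. by have [b1 h] := no_max b0; exists b1 => b; exact: lt_le_trans. Qed.

Definition grows (u : T -> option G) (n : nat) :=
  exists beta, tail (fun b => u b = Some (beta + gamma b *+ n)).

(** Two affine functions with different slopes cross at most once.  Past the
    crossing the one of larger slope dominates for good; if it never gets there,
    absence of a maximum for [gamma] makes the opposite inequality strict. *)
Lemma growth_cmp_lt u v m n : grows u m -> grows v n -> (m < n)%N ->
  tail (fun b => vlt (u b) (v b)) \/ tail (fun b => vlt (v b) (u b)).
Proof.
move=> [b ub] [c vc] mn.
have line g : (c + g *+ n <= b + g *+ m) = (c + g *+ (n - m) <= b).
  by rewrite -{1}(subnK (ltnW mn)) mulrnDr addrA oab_leD2.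
have nm0 : (0 < n - m)%N by rewrite subn_gt0.
have [[t0 ht0]|/forallNP all_le] := pselect (exists t, b < c + gamma t *+ (n - m)).
  left; have Q : tail (fun t => b < c + gamma t *+ (n - m)).
    exists t0 => t t0t; apply: lt_le_trans ht0 _.
    by rewrite oab_leD // oab_leMn.
  apply: tail_imp (tail_and Q (tail_and ub vc)) => t [h [-> ->]] /=.
  by rewrite oab_ltNge line -oab_ltNge.
right; apply: tail_imp (tail_and ub vc) => t [-> ->] /=.
have {}all_le t' : c + gamma t' *+ (n - m) <= b.
  by have /negP := all_le t'; rewrite oab_ltNge negbK.
rewrite oab_ltNge; apply/negP => h.
have [t' tt'] := no_max t; move: (all_le t'); apply/negP; rewrite -oab_ltNge.
apply: (@le_lt_trans _ _ (c + gamma t *+ (n - m))).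
  by move: h; rewrite -{1}(subnK (ltnW mn)) mulrnDr addrA oab_leD2.
by rewrite ![c + _]addrC oab_ltD2 oab_ltMn.
Qed.

Lemma growth_cmp u v m n : grows u m -> grows v n -> m != n ->
  tail (fun b => vlt (u b) (v b)) \/ tail (fun b => vlt (v b) (u b)).
Proof.
move=> gu gv; rewrite neq_ltn => /orP[mn|nm]; first exact: growth_cmp_lt gu gv mn.
by case: (growth_cmp_lt gv gu nm); [right | left].
Qed.

Lemma grows_slope u m n : grows u m -> grows u n -> m = n.
Proof.
move=> gm gn; apply/eqP; apply/negPn/negP => mn.
by case: (growth_cmp gm gn mn) => /tail_ex[b]; rewrite vltNge vle_refl.
Qed.

Lemma eq_grows u v n : u =1 v -> grows u n -> grows v n.
Proof. by move=> uv [c uc]; exists c; apply: tail_imp uc => b; rewrite uv. Qed.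

Lemma grows_ext u v n : tail (fun b => u b = v b) -> grows u n -> grows v n.
Proof.
by move=> uv [c uc]; exists c; apply: tail_imp (tail_and uv uc) => b [<-].
Qed.

Section Valued.
Variables (M : fieldType) (mu : valuation M G).
Implicit Types f g : T -> M.

Lemma growsM f g m n : grows (fun b => mu (f b)) m -> grows (fun b => mu (g b)) n ->
  grows (fun b => mu (f b * g b)) (m + n).
Proof.
move=> [b fb] [c gc]; exists (b + c); apply: tail_imp (tail_and fb gc) => t [ft gt].
by rewrite valM ft gt /= mulrnDr addrACA.
Qed.

Lemma growsX f m n : grows (fun b => mu (f b)) m ->
  grows (fun b => mu (f b ^+ n)) (m * n).
Proof.
move=> [b fb]; exists (b *+ n); apply: tail_imp fb => t ft.
by rewrite (valX n ft) mulrnDl mulrnA.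
Qed.

Lemma growsD f g m n : grows (fun b => mu (f b)) m -> grows (fun b => mu (g b)) n ->
  m != n ->
  grows (fun b => mu (f b + g b)) m \/ grows (fun b => mu (f b + g b)) n.
Proof.
move=> gf gg mn; case: (growth_cmp gf gg mn) => h; [left|right].
  by apply: grows_ext gf; apply: tail_imp h => b /val_addl ->.
by apply: grows_ext gg; apply: tail_imp h => b /val_addr ->.
Qed.

(** Terms growing with distinct slopes have distinct values on a tail, so that
    one of them carries the value of the sum. *)
Lemma grows_sum n (f : nat -> T -> M) (A : pred nat) (sigma : nat -> nat) :
  injective sigma ->
  (forall i, (i < n)%N -> A i -> grows (fun b => mu (f i b)) (sigma i)) ->
  (forall i, (i < n)%N -> ~~ A i -> forall b, f i b = 0) ->
  (exists2 i, (i < n)%N & A i) ->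
  exists i, [/\ (i < n)%N, A i & grows (fun b => mu (\sum_(i < n) f i b)) (sigma i)].
Proof.
move=> inj; elim: n => [|n IH] fA fN [i0 // i0n Ai0].
have {}IH := IH (fun i h => fA i (ltnW h)) (fun i h => fN i (ltnW h)).
have sumS b : \sum_(i < n.+1) f i b = \sum_(i < n) f i b + f n b.
  by rewrite big_ord_recr.
have [/IH[i1 [i1n Ai1 gr]]|/forall2NP noA] :=
  pselect (exists2 i, (i < n)%N & A i); last first.
  have {}i0n : i0 = n.
    move: i0n; rewrite ltnS leq_eqVlt => /orP[/eqP//|h].
    by case: (noA i0).
  rewrite {}i0n in Ai0; exists n; split=> //.
  apply: (eq_grows _ (fA n (ltnSn n) Ai0)) => b; rewrite sumS big1 ?add0r // => i _.
  apply: fN; first exact: ltnW (ltn_ord i).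
  by apply/negP; case: (noA i) => //=; rewrite ltn_ord.
have [An|nAn] := boolP (A n); last first.
  exists i1; split=> //; first exact: ltnW.
  by apply: (eq_grows _ gr) => b; rewrite sumS fN ?addr0.
have ne : sigma i1 != sigma n by rewrite (inj_eq inj) ltn_eqF.
case: (growsD gr (fA n (ltnSn n) An) ne) => h; [exists i1 | exists n]; split=> //.
- exact: ltnW.
- by apply: (eq_grows _ h) => b; rewrite sumS.
- by apply: (eq_grows _ h) => b; rewrite sumS.
Qed.

End Valued.
End Growth.

(** Iterated division by [g]; the bound on [i] says that [g ^+ i] has degree at
    most that of [P]. *)
Lemma base_expansion (K : fieldType) (g P : {poly K}) : (1 < size g)%N ->
  exists n (q : nat -> {poly K}), P = \sum_(i < n) q i * g ^+ i /\
    forall i, (size (q i) < size g)%N /\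
      (q i != 0 -> (i * (size g).-1 < size P)%N).
Proof.
move=> g1; have [m] := ubnP (size P); elim: m P => // m IH P Pm.
have g0 : g != 0 by rewrite -size_poly_gt0 ltnW.
have gpos : (0 < (size g).-1)%N by rewrite -subn1 subn_gt0.
have [Pg|gP] := ltnP (size P) (size g).
  exists 1%N, (fun i => if i is 0 then P else 0); split.
    by rewrite big_ord_recl big_ord0 expr0 mulr1 addr0.
  by move=> [|i]; split; rewrite ?size_poly0 ?eqxx ?size_poly_gt0 // ltnW.
have sizeQ : size (P %/ g)%R = (size P - (size g).-1)%N by rewrite size_divp.
have Ppos : (0 < size P)%N by apply: leq_trans gP; exact: ltnW.
have [|n [q [Pq qs]]] := IH (P %/ g).
  by rewrite sizeQ (leq_trans _ (_ : size P <= m)%N) // ltn_subrL gpos.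
exists n.+1, (fun i => if i is j.+1 then q j else P %% g); split.
  rewrite big_ord_recl expr0 mulr1 {1}(divp_eq P g) addrC {1}Pq big_distrl /=.
  by congr (_ + _); apply: eq_bigr => i _; rewrite -mulrA -exprSr.
move=> [|i]; first by rewrite ltn_modp g0 mul0n Ppos.
have [q1 q2] := qs i; split=> // /q2; rewrite sizeQ ltn_subRL.
by rewrite mulSn.
Qed.

Section ImmediateCase.
Variables (K : fieldType) (L : fieldExtType K) (G : orderedAbType).
Variables (nu0 : valuation K G) (nu : valuation L G) (p : nat) (a : K) (theta : L).
Variable gamma : K -> G.
Hypotheses (ext : extends nu0 nu) (pK : p \in [pchar K]).
Hypothesis gen : forall x : L,
  exists2 g : {poly K}, (size g <= p)%N & x = horner_alg theta g.
Hypothesis no_max : forall b, exists b', gamma b < gamma b'.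
Hypothesis val_theta : forall b, nu (theta - b%:A) = Some (gamma b).
Hypothesis val_F : forall b, nu0 (artin_schreier p a).[b] = Some (gamma b *+ p).

(** Where this holds, [g(b)] and [g(theta)] have the same value, and the same
    residue if that value is 0. *)
Definition approximates (g : {poly K}) :=
  tail gamma (fun b => vlt (nu (horner_alg theta g))
                           (nu (horner_alg theta g - (g.[b])%:A))).

Lemma approximates_val g : approximates g ->
  tail gamma (fun b => nu (horner_alg theta g) = nu0 g.[b]).
Proof.
apply: tail_imp => b h; rewrite -(ext g.[b]).
by rewrite -[X in _ = nu X](subKr (horner_alg theta g)) addrC val_addr // valN.
Qed.

Lemma approximates_grows g : approximates g -> grows gamma (fun b => nu0 g.[b]) 0.
Proof.
move=> ag; have [w gw] : exists w, nu (horner_alg theta g) = Some w.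
  have [b] := tail_ex ag; case: (nu (horner_alg theta g)) => [w|] //; by exists w.
exists w; apply: tail_imp (approximates_val ag) => b <-.
by rewrite gw mulr0n addr0.
Qed.

Lemma approximates_const (c : K) : c != 0 -> approximates c%:P.
Proof.
move=> c0; exists 0 => b _; rewrite hornerC horner_algC subrr val0 ext.
by have [w ->] := val_Some nu0 c0.
Qed.

(** With [c] the root of [g], the inequality compares [theta - b] with
    [theta - c], and it holds as soon as [b] is closer to [theta] than [c]. *)
Lemma approximates_linear (g : {poly K}) : size g = 2%N -> approximates g.
Proof.
move=> sg; have g1 : g`_1 != 0.
  by have := lead_coef_eq0 g; rewrite lead_coefE sg /= -size_poly_eq0 sg => ->.
have gE : g = g`_1 *: ('X - (- g`_0 / g`_1)%:P).
  apply/polyP => i; rewrite coefZ coefB coefX coefC.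
  case: i => [|[|i]] /=; last 1 first.
  - by rewrite nth_default ?sg // subr0 mulr0.
  - by rewrite sub0r mulNr opprK mulrC divfK.
  - by rewrite subr0 mulr1.
set d := g`_1 in g1 gE; set c := (_ / _) in gE; have [w dw] := val_Some nu0 g1.
have evE : horner_alg theta g = d%:A * (theta - c%:A).
  by rewrite gE linearZ /= rmorphB /= horner_algX horner_algC mulr_algl.
apply: tail_imp (tail_strict no_max c) => b cb.
have -> : horner_alg theta g - (g.[b])%:A = d%:A * (theta - b%:A).
  rewrite evE {1}gE hornerZ hornerXsubC -(mulr_algl d) !mulr_algl.
  by rewrite -scalerA -scalerBr scalerBl opprB addrA subrK.
rewrite evE !valM ext dw !val_theta /= ![w + _]addrC oab_ltD2 //.
Qed.

(** By induction on the degree, the Hasse derivatives of [g] satisfy the claim,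
    so the terms of the Taylor expansion of [g(theta) - g(b)] at [b] grow with
    the distinct slopes 1, 2, ..., and the difference grows with one of these,
    [r].  Unless [nu (g theta)] is eventually smaller, [nu0 (g b)] grows with
    slope [r] as well.  In the expansion of [F] in base [g] the digits [q i] have
    lower degree, hence eventually constant value, so that [nu0 (F b)] grows with
    a slope [i r]; but that slope is [p].  As [r <= deg g < p] and
    [i deg g <= p], this leaves [r = 1], [i = p] and [deg g = 1]. *)
Lemma approximates_all (g : {poly K}) : g != 0 -> (size g <= p)%N -> approximates g.
Proof.
have p_pr := pcharf_prime pK; have p_gt1 := prime_gt1 p_pr.
have [m] := ubnP (size g); elim: m g => // m IH g gm g0 gp.
have [g1|g1] := leqP (size g) 1.
  have [c c0 ->] : exists2 c, c != 0 & g = c%:P.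
    exists g`_0; last exact: size1_polyC.
    by rewrite -polyC_eq0 -size1_polyC.
  exact: approximates_const.
have [g2|g2] := eqVneq (size g) 2%N; first exact: approximates_linear.
set k := (size g).-1; have gk : size g = k.+1 by rewrite prednK // ltnW.
have {}IH (h : {poly K}) : (size h < size g)%N -> h != 0 ->
    grows gamma (fun b => nu0 h.[b]) 0.
  move=> hg h0; apply/approximates_grows/IH => //; last exact: leq_trans (ltnW hg) gp.
  exact: leq_trans hg _.
have IHL (h : {poly K}) : (size h < size g)%N -> h != 0 ->
    grows gamma (fun b => nu (h.[b])%:A) 0.
  by move=> hg h0; apply: (eq_grows _ (IH h hg h0)) => b /=; rewrite ext.
pose t i b := ((g^`N(i.+1)).[b])%:A * (theta - b%:A) ^+ i.+1.
have taylor b : horner_alg theta g - (g.[b])%:A = \sum_(i < k) t i b.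
  have := @nderiv_taylor _ (map_poly (in_alg L) g) b%:A (theta - b%:A) (mulrC _ _).
  rewrite size_map_poly gk big_ord_recl nderivn0 expr0 mulr1 subrKC.
  rewrite -[X in X = _]/(horner_alg theta g) => ->.
  rewrite in_alg_horner [_ + \sum_(_ < _) _]addrC addrK.
  by apply: eq_bigr => i _; rewrite /t in_alg_horner nderivn_map.
have lin : grows gamma (fun b => nu (theta - b%:A)) 1.
  by exists 0; exists 0 => b _; rewrite val_theta add0r.
have size_nd i : (size g^`N(i.+1) < size g)%N.
  rewrite gk ltnS; apply/leq_sizeP => j kj; rewrite coef_nderivn nth_default ?mul0rn //.
  by rewrite gk addSn ltnS (leq_trans kj) // leq_addl.
have k_gt1 : (1 < k)%N by move: g1 g2; rewrite gk; case: (k) => [|[]].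
have [|i ip Ai|i ip /negPn/eqP e b||r [rk Ar gr]] :=
    @grows_sum _ _ _ no_max _ nu k t (fun i => g^`N(i.+1) != 0) S.
- exact: succn_inj.
- have := growsM (IHL _ (size_nd i) Ai) (growsX i.+1 lin).
  by rewrite add0n mul1n.
- by rewrite /t e horner0 scale0r mul0r.
- exists k.-1; first by rewrite prednK // ltnW.
  rewrite prednK ?(ltnW k_gt1) //; apply/eqP => /(congr1 (fun h : {poly K} => h`_0)).
  rewrite coef_nderivn coef0 addn0 binn mulr1n => /eqP.
  by have := lead_coef_eq0 g; rewrite lead_coefE => ->; exact/negP.
have {}gr : grows gamma (fun b => nu (horner_alg theta g - (g.[b])%:A)) r.+1.
  by apply: (eq_grows _ gr) => b; rewrite taylor.
have valE b : vlt (nu (horner_alg theta g - (g.[b])%:A)) (nu (horner_alg theta g)) ->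
    nu (horner_alg theta g - (g.[b])%:A) = nu0 g.[b].
  move=> h; rewrite -(ext g.[b]) -[X in _ = nu X](subKr (horner_alg theta g)).
  by rewrite [RHS]val_addr ?valN.
(* The index [r] counts from 0, so that the slope is [r.+1]. *)
suff bad : ~ grows gamma (fun b => nu0 g.[b]) r.+1.
  case E : (nu (horner_alg theta g)) => [w|]; last first.
    case: bad; have [c gc] := gr; exists c; apply: tail_imp gc => b yb.
    by rewrite -valE // yb E.
  have cst : grows gamma (fun=> nu (horner_alg theta g)) 0.
    by exists w; exists 0 => b _; rewrite mulr0n addr0.
  case: (growth_cmp no_max cst gr) => // h; case: bad.
  by apply: (grows_ext _ gr); apply: tail_imp h => b; exact: valE.
move=> bad.
have [n [q [Fq qs]]] := base_expansion (artin_schreier p a) g1.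
have sF : size (artin_schreier p a) = p.+1 by exact: size_artin_schreier.
have [|i ip qi|i ip /negPn/eqP e b||i [ip qi grF]] :=
    @grows_sum _ _ _ no_max _ nu0 n (fun i b => (q i).[b] * g.[b] ^+ i)
      (fun i => q i != 0) (fun i => r.+1 * i)%N.
- by move=> i j /eqP; rewrite eqn_pmul2l // => /eqP.
- have := growsM (IH _ (qs i).1 qi) (growsX i bad).
  by rewrite add0n.
- by rewrite e horner0 mul0r.
- apply: contrapT => /forall2NP none.
  have := size_poly0 K; rewrite -(_ : artin_schreier p a = 0) ?sF // Fq big1 // => i _.
  by case: (none i) => [/(_ (ltn_ord i))//|/negP/negPn/eqP ->]; rewrite mul0r.
have : (r.+1 * i = p)%N.
  apply: (grows_slope no_max (u := fun b => nu0 (artin_schreier p a).[b])).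
    apply: (eq_grows _ grF) => b; rewrite Fq horner_sum.
    by congr (nu0 _); apply: eq_bigr => j _; rewrite hornerM horner_exp.
  by exists 0; exists 0 => b _; rewrite val_F add0r.
move=> rip; have : (r.+1 %| p)%N by rewrite -rip dvdn_mulr.
case/primeP: (p_pr) => _ h /h /orP[/eqP r0|/eqP rp].
  rewrite r0 mul1n in rip; have [_ /(_ qi)] := qs i.
  rewrite sF rip gk /= ltnS -{2}[p]muln1 leq_pmul2l ?prime_gt0 //.
  by rewrite leqNgt k_gt1.
by move: rk; rewrite rp leqNgt -gk gp.
Qed.

Lemma approximation (x : L) : x != 0 -> exists2 g : {poly K}, x = horner_alg theta g &
  tail gamma (fun b => vlt (nu x) (nu (x - (g.[b])%:A))).
Proof.
have [g gp ->] := gen x; exists g => //; apply: approximates_all => //.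
by apply: contra_neq H => ->; rewrite rmorph0.
Qed.

Lemma immediate_value_group : value_group nu = value_group nu0.
Proof.
apply/seteqP; split=> g [x xg]; last by exists x%:A; rewrite ext.
have [h xh apx] := approximation (val_neq0 xg).
have [b] := tail_ex apx; rewrite xg => /= lt; exists h.[b].
have lt' : vlt (nu x) (nu (- (x - (h.[b])%:A))) by rewrite valN xg.
by rewrite -(ext h.[b]) -(subKr x (h.[b])%:A) (val_addl lt').
Qed.

Lemma immediate_ramification : ramification_index nu0 nu = 1%N.
Proof.
rewrite /ramification_index -immediate_value_group.
apply: (@group_index_cyclic _ _ _ _ 0).
- exact: value_group0.
- exact: value_groupB.
- by move=> [|i] [|j].
- by move=> g; split=> [gG|[i _]]; [exists 0%N => //|]; rewrite mul0rn subr0.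
Qed.

(** The residue of [x] is that of [g(b)] for [b] close to [theta], so that the
    residue fields coincide and 1 is a basis. *)
Lemma immediate_inertia : inertia_degree nu0 nu = 1%N.
Proof.
apply: (@ext_degree_basis _ _ (residue_hom ext) 1 (fun=> 1)) => y.
suff [u ->] : exists u, y = residue_hom ext u.
  exists [ffun=> u]; split=> [|c]; first by rewrite big_ord1 ffunE mulr1.
  rewrite big_ord1 mulr1 => /fmorph_inj ->; apply/ffunP => i.
  by rewrite ffunE (ord1 i).
set x := residue_repr y; have xO : x \in val_ring nu by exact: residue_repr_ring.
have [x0|x0] := eqVneq x 0.
  by exists 0; rewrite rmorph0 -[y]residue_reprK -/x x0 reduce0.
have [h xh apx] := approximation x0; have [b lt] := tail_ex apx.
have x_ge0 : vle (Some 0) (nu x) by exact: xO.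
have hO : (h.[b])%:A \in val_ring nu.
  rewrite -(subKr x (h.[b])%:A) rpredB // unfold_in /val_ring.
  by rewrite (vle_trans x_ge0) ?vltW.
exists (reduce nu0 h.[b]).
rewrite /residue_hom residue_map_reduce -?(alg_val_ring ext) //.
rewrite -[LHS]residue_reprK; apply/eqP; rewrite reduce_eq //.
exact: vle_lt_trans lt.
Qed.

End ImmediateCase.

Lemma immediate_uniq (K : fieldType) (L : fieldExtType K) (G : orderedAbType)
    (nu0 : valuation K G) (nu nu' : valuation L G) (p : nat) (a : K) (theta : L)
    (gamma : K -> G) :
  extends nu0 nu -> extends nu0 nu' -> p \in [pchar K] ->
  (forall x : L, exists2 g : {poly K}, (size g <= p)%N & x = horner_alg theta g) ->
  (forall b, exists b', gamma b < gamma b') ->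
  (forall b, nu (theta - b%:A) = Some (gamma b)) ->
  (forall b, nu' (theta - b%:A) = Some (gamma b)) ->
  (forall b, nu0 (artin_schreier p a).[b] = Some (gamma b *+ p)) ->
  nu = nu'.
Proof.
move=> ext ext' pK gen no_max vt vt' vF; apply: valuationP => x.
have [g gp ->] := gen x; have [->|g0] := eqVneq g 0; first by rewrite rmorph0 !val0.
have ap := approximates_val ext (approximates_all ext pK no_max vt vF g0 gp).
have ap' := approximates_val ext' (approximates_all ext' pK no_max vt' vF g0 gp).
by have [b [-> ->]] := tail_ex (tail_and ap ap').
Qed.

(** * Artin-Schreier generators of nonpositive distance *)

(** If [x] has negative value then [x^p] dominates [x], and the value of
    [x^p - x] is [p] times that of [x]; if [x] has value at least 0, then so
    does [x^p - x], strictly if [x] does. *)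
Lemma val_artin_schreier_le0 (M : fieldType) (G : orderedAbType)
    (mu : valuation M G) p (x : M) s : (1 < p)%N -> s <= 0 ->
  mu (x ^+ p - x) = Some (s *+ p) -> mu x = Some s.
Proof.
move=> p1 s0 e; have p0 : (0 < p)%N by exact: ltnW.
have ltp (g : G) : g < 0 -> g *+ p < g.
  case: p p1 {p0 e} => [|[|p]] // _ g0; rewrite mulrSr -[X in _ < X]add0r oab_ltD2.
  by rewrite -(mul0rn _ p.+1) oab_ltMn.
case E: (mu x) => [g|]; last first.
  by move/val_eqoo: E e => ->; rewrite expr0n subr0 gtn_eqF // val0.
have [g0|] := boolP (g < 0).
  move: e; rewrite val_addl ?valN ?(valX _ E) ?E; last exact: ltp.
  by case=> /(oab_mulIn p0) ->.
rewrite oab_ltNge negbK => g0.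
have : vle (Some 0) (mu (x ^+ p - x)).
  by apply: val_leadd; rewrite ?valN ?valX0 // E.
rewrite e /= -[X in X <= _](mul0rn _ p) oab_leMnE // => s0'.
have {}s0 : s = 0 by apply/eqP; rewrite eq_le s0 s0'.
subst s; congr Some; apply/eqP; rewrite eq_le g0 andbT.
apply: contraTT (isT) => gn; have {gn} g_gt0 : 0 < g by rewrite oab_ltNge.
have : vlt (Some 0) (mu (x ^+ p - x)).
  apply: val_ltadd; rewrite ?valN ?(valX _ E) ?E //=.
  by rewrite -[X in X < _](mul0rn _ p) oab_ltMn.
by rewrite e mul0rn /= ltxx.
Qed.

Lemma val_artin_schreier_gt0 (M : fieldType) (G : orderedAbType)
    (mu : valuation M G) p (x : M) : (1 < p)%N -> vlt (Some 0) (mu x) ->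
  mu (x ^+ p - x) = mu x.
Proof.
move=> p1; have [->|xn0 x0] := eqVneq x 0.
  by rewrite expr0n subr0 gtn_eqF // ltnW.
rewrite val_addr valN //; have [g E] := val_Some mu xn0.
move: x0; rewrite (valX _ E) E /=; case: p p1 => [|[|p]] // _ g0.
by rewrite mulrSr -[X in X < _]add0r oab_ltD2 -(mul0rn _ p.+1) oab_ltMn.
Qed.

Section ArtinSchreierExtension.
Variables (K : fieldType) (L : fieldExtType K) (G : orderedAbType).
Variables (nu0 : valuation K G) (p : nat) (a : K) (theta : L).
Hypotheses (divG : divisible G) (pK : p \in [pchar K]).
Local Notation F := (artin_schreier p a).
Hypothesis theta_root : horner_alg theta F = 0.
Hypothesis gen : forall x : L,
  exists2 g : {poly K}, (size g <= p)%N & x = horner_alg theta g.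
Implicit Types nu : valuation L G.

Let p_pr : prime p := pcharf_prime pK.
Let p_gt1 : (1 < p)%N := prime_gt1 p_pr.
Let p_gt0 : (0 < p)%N := prime_gt0 p_pr.
Let pL : p \in [pchar L]. Proof. by rewrite pchar_lalg. Qed.

Lemma theta_sub b : (theta - b%:A) ^+ p - (theta - b%:A) = - (F.[b])%:A.
Proof.
have : theta ^+ p - theta = a%:A.
  apply/eqP; rewrite -subr_eq0 -theta_root /artin_schreier.
  by rewrite !rmorphB rmorphXn /= horner_algX horner_algC.
rewrite exprBp // horner_artin_schreier => e.
have -> : b%:A ^+ p = (b ^+ p)%:A :> L by rewrite exprZn expr1n.
rewrite !scalerBl -e opprB [RHS]opprB (opprB _ b%:A) addrACA [RHS]addrACA.
by congr (_ + _); exact: addrC.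
Qed.

Lemma gen_affine b d : d != 0 -> forall x : L,
  exists2 h : {poly K}, (size h <= p)%N & x = horner_alg (d^-1 *: (theta - b%:A)) h.
Proof.
move=> d0 x; have [g gp ->] := gen x.
exists (g \Po (d *: 'X + b%:P)).
  rewrite size_comp_poly2 // size_addl size_scale // size_polyX //.
  by rewrite ltnS size_polyC_leq1.
rewrite horner_alg_comp; set y := d^-1 *: _.
rewrite rmorphD /= linearZ /= horner_algX horner_algC.
by rewrite mulr_algl scalerA divff // scale1r subrK.
Qed.

(** The distance from the root to [b] is the same for all extensions. *)
Lemma val_theta_sub nu b s : extends nu0 nu -> s <= 0 ->
  nu0 F.[b] = Some (s *+ p) -> nu (theta - b%:A) = Some s.
Proof.
move=> ext s0 e; apply: (val_artin_schreier_le0 p_gt1) => //.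
by rewrite theta_sub valN ext.
Qed.

Section Ramified.
Variables (b : K) (s : G).

Hypotheses (s0 : s <= 0) (val_b : nu0 F.[b] = Some (s *+ p)).
Hypothesis s_notin : ~ value_group nu0 s.

Let sp_in : value_group nu0 (s *+ p). Proof. by exists F.[b]. Qed.

(** The factor [1^-1] keeps the generator in the shape of [gen_affine]. *)
Lemma ramified_monomial nu : extends nu0 nu ->
  monomial_val nu0 p (1^-1 *: (theta - b%:A)) s nu.
Proof.
move=> ext; rewrite invr1 scale1r.
apply: (monomial_val_distinct ext p_gt0 (val_theta_sub ext s0 val_b)) => i j.
exact: value_group_prime_index.
Qed.

Lemma ramified_index nu : extends nu0 nu -> ramification_index nu0 nu = p.
Proof.
move=> ext; apply: (@group_index_cyclic _ _ _ _ s).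
- exact: value_group0.
- exact: value_groupB.
- by move=> i j; exact: value_group_prime_index.
move=> g; split=> [[x xg]|[i ip [c cg]]]; last first.
  exists (c%:A * (theta - b%:A) ^+ i).
  rewrite valM ext cg (valX i (val_theta_sub ext s0 val_b)) /=.
  by rewrite subrK.
have [h hp xh] := gen_affine b (oner_neq0 _) x.
have [i ip [e _]] := ramified_monomial ext hp; exists i => //.
move: e; rewrite -xh xg; case E: (nu0 _) => [k|] //= [->].
by rewrite addrK; exists h`_i.
Qed.

End Ramified.

Section Inert.
Variables (b d : K) (m : G).
Hypotheses (m0 : m <= 0) (val_b : nu0 F.[b] = Some (m *+ p)).
(* For [m = 0] the choice [d = 1] makes the residue of [(theta - b) / d] a root
   of [X^p - X - u], with no coefficient in front of [X]. *)
Hypotheses (val_d : nu0 d = Some m) (d1 : m = 0 -> d = 1).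
Hypothesis max : forall b', vle (nu0 F.[b']) (Some (m *+ p)).

Let eta := d^-1 *: (theta - b%:A).
Let d0 : d != 0 := val_neq0 val_d.

Section Fixed.
Variable nu : valuation L G.
Hypothesis ext : extends nu0 nu.
Let phi : {rmorphism residue nu0 -> residue nu} := residue_hom ext.

Lemma inert_val_eta : nu eta = Some 0.
Proof.
rewrite /eta -(mulr_algl d^-1) valM ext (valV val_d) (val_theta_sub ext m0 val_b) /=.
by rewrite addNr.
Qed.

Let etaO : eta \in val_ring nu.
Proof. by rewrite unfold_in /val_ring inert_val_eta /=. Qed.

(** If [t] in [K] had the same residue as [(theta - b) / d], then [b + d t] would
    be closer to the root than [m], against maximality. *)
Lemma inert_not_residue u : reduce nu eta <> phi u.
Proof.
rewrite -[u]residue_reprK; set t := residue_repr u.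
have tO : t \in val_ring nu0 by exact: residue_repr_ring.
rewrite /phi /= /residue_hom residue_map_reduce // => /eqP.
rewrite reduce_eq ?(alg_val_ring ext) // => lt.
have e : eta - t%:A = (d^-1)%:A * (theta - (b + d * t)%:A).
  rewrite (mulr_algl d^-1) scalerDl opprD addrA scalerBr scalerA mulrA mulVf // mul1r.
  by [].
have [s' [s'0 vs']] : exists s', s' <= m /\ nu0 F.[b + d * t] = Some (s' *+ p).
  case E: (nu0 F.[b + d * t]) (max (b + d * t)) => [g|] //= gm.
  have [s' s'g] := divG g p_gt0; exists s'; rewrite -s'g; split=> //.
  by rewrite -(oab_leMnE _ _ p_gt0) s'g.
move: lt; rewrite e valM ext (valV val_d).
rewrite (val_theta_sub ext (le_trans s'0 m0) vs') /= addrC -(oab_ltD2 m) subrK add0r.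
by rewrite oab_ltNge s'0.
Qed.

(** For [m = 0] the residue [rho] satisfies [rho^p - rho = u] with [u] the residue
    of [- F(b)].  For [m < 0] the linear term of the equation, divided by
    [d^p], has value [m - p m > 0], and only [rho^p = u] remains.  In both cases
    the other roots are translates of [rho] by residues of [K]. *)
Lemma inert_indep (h : {poly residue nu0}) : h != 0 -> (size h <= p)%N ->
  (map_poly phi h).[reduce nu eta] != 0.
Proof.
have pk : p \in [pchar residue nu] by exact: (pchar_residue _ pK).
have powO : eta ^+ p \in val_ring nu by rewrite rpredX.
set rho := reduce nu eta.
case: (eqVneq m 0) => [m00|m_neq0].
  pose u := reduce nu0 (- F.[b]).
  have FO : - F.[b] \in val_ring nu0.
    by rewrite unfold_in /val_ring valN val_b m00 mul0rn /=.
  have phiu : phi u = rho ^+ p - rho.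
    rewrite /phi /= /residue_hom residue_map_reduce //.
    rewrite -reduceX //; apply: (addIr rho); rewrite subrK -reduceD ?(alg_val_ring ext) //.
    congr (reduce nu _); rewrite /eta (d1 m00) invr1 scale1r scaleNr -theta_sub.
    by rewrite subrK.
  have rsp : size [seq rho + j%:R | j <- iota 0 p] = p by rewrite size_map size_iota.
  move=> h0; rewrite -{1}rsp; apply: (translate_roots_indep (P := artin_schreier p u)) => //.
  - by rewrite rsp.
  - rewrite -artin_schreier_prod // /artin_schreier -phiu.
    by rewrite !rmorphB /= map_polyC map_polyXn map_polyX.
  - by move=> _ /mapP[j _ ->]; exists j%:R; rewrite rmorph_nat.
  - by apply/mapP; exists 0%N; rewrite ?mem_iota ?addr0.
  - exact: inert_not_residue.
pose u := reduce nu0 (- F.[b] / d ^+ p).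
have FO : - F.[b] / d ^+ p \in val_ring nu0.
  rewrite unfold_in /val_ring valM valN val_b (valV (valX _ val_d)) /=.
  by rewrite subrr.
have phiu : phi u = rho ^+ p.
  rewrite /phi /= /residue_hom residue_map_reduce // -reduceX //; apply/eqP.
  rewrite reduce_eq ?(alg_val_ring ext) //.
  have -> : (- F.[b] / d ^+ p)%:A - eta ^+ p = - ((d ^- p) *: (theta - b%:A)).
    rewrite /eta exprZn exprVn mulrC -scalerA -scalerBr -(scalerN (d ^- p)) scaleNr.
    by rewrite -theta_sub; set y := theta - _; rewrite [_ - y]addrC addrK.
  rewrite valN -(mulr_algl (d ^- p)) valM ext (valV (valX _ val_d)).
  rewrite (val_theta_sub ext m0 val_b) /= addrC oab_subr_gt0.
  have {m_neq0} m_lt0 : m < 0 by rewrite lt_neqAle m_neq0.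
  case: (p) p_gt1 => [|[|q]] // _; rewrite mulrSr -[X in _ < X]add0r oab_ltD2.
  by rewrite -(mul0rn _ q.+1) oab_ltMn.
move=> h0; rewrite -{1}(size_nseq p rho).
apply: (translate_roots_indep (P := 'X^p - u%:P)) => //.
- by rewrite size_nseq.
- by rewrite -expp_prod // -phiu rmorphB /= map_polyC map_polyXn.
- by move=> _ /nseqP[-> _]; exists 0; rewrite rmorph0 addr0.
- by apply/nseqP.
- exact: inert_not_residue.
Qed.

Lemma inert_monomial : monomial_val nu0 p eta 0 nu.
Proof. exact: (monomial_val_residual p_gt0 inert_val_eta inert_indep). Qed.

Lemma inert_degree : inertia_degree nu0 nu = p.
Proof.
apply: (residual_basis_degree p_gt0 inert_val_eta inert_indep).
exact: gen_affine.
Qed.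

End Fixed.
End Inert.
End ArtinSchreierExtension.

(** * Extensions obtained as limits along a sequence *)

Definition eventually (P : nat -> Prop) := exists N, forall n, (N <= n)%N -> P n.

Lemma eventually_and P Q : eventually P -> eventually Q ->
  eventually (fun n => P n /\ Q n).
Proof.
move=> [N PN] [M QM]; exists (maxn N M) => n.
by rewrite geq_max => /andP[Nn Mn]; split; [exact: PN | exact: QM].
Qed.

Lemma eventually_imp (P Q : nat -> Prop) :
  (forall n, P n -> Q n) -> eventually P -> eventually Q.
Proof. by move=> PQ [N PN]; exists N => n /PN /PQ. Qed.

Lemma eventually_ex P : eventually P -> exists n, P n.
Proof. by move=> [N PN]; exists N; exact: PN. Qed.

(* Sequences are considered in an arbitrary valued extension [M] of [K], with
   [K] itself and [L] in view; the thresholds are taken in the value group of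
   [nu0], which need not be cofinal in [G]. *)
Section NullSequences.
Variables (K M : fieldType) (G : orderedAbType) (iota : {rmorphism K -> M}).
Variables (nu0 : valuation K G) (mu : valuation M G).
Hypothesis mu_iota : forall c, mu (iota c) = nu0 c.
Local Notation Gamma := (value_group nu0).
Implicit Types u v : nat -> M.

Definition bounded u := exists2 w, Gamma w & forall n, vle (Some w) (mu (u n)).

Definition null u := forall w, Gamma w -> eventually (fun n => vlt (Some w) (mu (u n))).

Lemma bounded_cst c : bounded (fun=> iota c).
Proof.
have [->|/(val_Some nu0)[w cw]] := eqVneq c 0.
  by exists 0 => [|n]; [exact: value_group0 | rewrite rmorph0 val0].
by exists w => [|n]; [exists c | rewrite mu_iota cw vle_refl].
Qed.

Lemma boundedD u v : bounded u -> bounded v -> bounded (fun n => u n + v n).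
Proof.
move=> [w wG wu] [w' w'G wv]; case/orP: (oab_total w w') => ww.
  by exists w => // n; apply: val_leadd => //; apply: vle_trans (wv n).
by exists w' => // n; apply: val_leadd => //; apply: vle_trans (wu n).
Qed.

Lemma boundedM u v : bounded u -> bounded v -> bounded (fun n => u n * v n).
Proof.
move=> [w wG wu] [w' w'G wv]; exists (w + w'); first exact: value_groupD.
by move=> n; rewrite valM; exact: (vle_add (wu n) (wv n)).
Qed.

Lemma nullD u v : null u -> null v -> null (fun n => u n + v n).
Proof.
move=> nu nv w wG; apply: eventually_imp (eventually_and (nu w wG) (nv w wG)) => n.
by case; exact: val_ltadd.
Qed.

Lemma nullM u v : null u -> bounded v -> null (fun n => u n * v n).
Proof.
move=> nu [w' w'G wv] w wG.
apply: eventually_imp (nu (w - w') (value_groupB wG w'G)) => n h.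
rewrite valM; move: (wv n) h; case: (mu (u n)) (mu (v n)) => [g|] [h|] //= wh wg.
by rewrite -(subrK w' w); exact: oab_lt_leD.
Qed.

Lemma eq_null u v : u =1 v -> null u -> null v.
Proof. by move=> /funext ->. Qed.

Lemma bounded_horner (g : {poly K}) u : bounded u ->
  bounded (fun n => (map_poly iota g).[u n]).
Proof.
move=> bu; elim/poly_ind: g => [|g c IH].
  have [w wG h] := bounded_cst 0; exists w => // n.
  by rewrite rmorph0 horner0 val0.
have [w wG h] := boundedD (boundedM IH bu) (bounded_cst c); exists w => // n.
by rewrite rmorphD rmorphM /= map_polyX map_polyC hornerD hornerMX hornerC; exact: h.
Qed.

Lemma null_horner (g : {poly K}) u v : bounded u -> bounded v ->
  null (fun n => u n - v n) ->
  null (fun n => (map_poly iota g).[u n] - (map_poly iota g).[v n]).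
Proof.
move=> bu bv nuv; elim/poly_ind: g => [|g c IH].
  by move=> w _; exists 0%N => n _; rewrite rmorph0 !horner0 subr0 val0.
apply: eq_null (nullD (nullM IH bu) (nullM nuv (bounded_horner g bv))) => n.
rewrite rmorphD rmorphM /= map_polyX map_polyC !hornerD !hornerMX !hornerC.
set s := _.[_]; set t := _.[_]; rewrite opprD addrACA subrr addr0.
by rewrite !mulrBl [u n * t]mulrC [v n * t]mulrC addrA subrK.
Qed.

End NullSequences.

Section LimitValuation.
Variables (K : fieldType) (L : fieldExtType K) (G : orderedAbType).
Variables (nu0 : valuation K G) (F : {poly K}) (theta : L) (x : nat -> K).
Hypotheses (irr : irreducible_poly F) (theta_root : horner_alg theta F = 0).
Hypothesis gen : forall y : L, exists g : {poly K}, y = horner_alg theta g.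
Hypotheses (x_bounded : bounded nu0 nu0 x).
Hypotheses (x_cauchy : null nu0 nu0 (fun n => x n.+1 - x n)).
Hypotheses (x_root : null nu0 nu0 (fun n => F.[x n])).
Local Notation Gamma := (value_group nu0).

Let id_val c : nu0 ((idfun : {rmorphism K -> K}) c) = nu0 c. Proof. by []. Qed.

Lemma horner_bounded (g : {poly K}) : bounded nu0 nu0 (fun n => g.[x n]).
Proof. by have := bounded_horner id_val g x_bounded; rewrite map_poly_id. Qed.

(** From [u F + v g = 1] and [F(x_n) -> 0], the value of [v(x_n) g(x_n)] is
    eventually 0; since [v(x_n)] has value at least some [c], that of [g(x_n)] is
    at most [-c].  The differences [g(x_(n+1)) - g(x_n)] tend to 0, so eventually
    they cannot change the value of [g(x_n)]. *)
Lemma horner_stable (g : {poly K}) : ~~ (F %| g) ->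
  exists2 w, Gamma w & eventually (fun n => nu0 g.[x n] = Some w).
Proof.
rewrite -irreducible_poly_coprime // => /Bezout_eq1_coprimepP[[u v] /= uv].
have [c cG vc] := horner_bounded v.
have cN : Gamma (- c) by exact: value_groupN.
have uF : eventually (fun n => vlt (Some 0) (nu0 (F.[x n] * u.[x n]))).
  by apply: (nullM x_root (horner_bounded u)); exact: value_group0.
have diff : eventually (fun n => vlt (Some (- c)) (nu0 (g.[x n.+1] - g.[x n]))).
  have b1 : bounded nu0 nu0 (fun n => x n.+1).
    by have [w wG h] := x_bounded; exists w.
  have := null_horner id_val g b1 x_bounded x_cauchy.
  by rewrite map_poly_id //; apply.
have [N HN] := eventually_and uF diff.
have small n : (N <= n)%N -> vle (nu0 g.[x n]) (Some (- c)).
  move=> /HN[h _]; have : nu0 (v.[x n] * g.[x n]) = Some 0.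
    have -> : v.[x n] * g.[x n] = 1 - F.[x n] * u.[x n].
      have := congr1 (fun f : {poly K} => f.[x n]) uv; rewrite /= !hornerE => <-.
    by rewrite [u.[_] * _]mulrC addrC addKr.
    by rewrite val_addl ?val1 // valN.
  rewrite valM; move: (vc n); case: (nu0 v.[_]) (nu0 g.[_]) => [k|] [l|] //= ck [kl].
  by rewrite -(oab_leD2 k) addrC kl addrC oab_subr_ge0.
have step n : (N <= n)%N -> nu0 g.[x n.+1] = nu0 g.[x n].
  move=> Nn; have [_ d] := HN n Nn; rewrite -(subrK g.[x n] g.[x n.+1]).
  by rewrite val_addr //; exact: vle_lt_trans (small n Nn) d.
have [w gw] : exists w, nu0 g.[x N] = Some w.
  by have := small N (leqnn N); case: (nu0 _) => // w _; exists w.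
exists w; first by exists g.[x N].
exists N => n /subnK <-; elim: (n - N)%N => [|k IH]; first by rewrite add0n.
by rewrite addSn step // leq_addl.
Qed.

Lemma theta_rep (g h : {poly K}) : horner_alg theta g = horner_alg theta h ->
  F %| g - h.
Proof.
move=> e; rewrite -(irreducible_root_dvdp _ irr theta_root).
by rewrite rmorphB /= e subrr.
Qed.

(** The eventual value depends only on [y]: two polynomials representing [y]
    differ by a multiple of [F], whose value at [x_n] tends to infinity. *)
Lemma limit_spec (y : L) : exists v : option G,
  (y = 0 -> v = None) /\
  (y != 0 -> (exists w, v = Some w) /\
     forall g, y = horner_alg theta g -> eventually (fun n => nu0 g.[x n] = v)).
Proof.
have [->|y0] := eqVneq y 0; first by exists None.
have [g yg] := gen y; have ng : ~~ (F %| g).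
  by rewrite -(irreducible_root_dvdp _ irr theta_root) -yg.
have [w wG gw] := horner_stable ng; exists (Some w); split=> [e|_].
  by rewrite e eqxx in y0.
split; first by exists w.
move=> h yh; have /dvdpP[q hg] : F %| h - g by apply: theta_rep; rewrite -yh.
have qF := nullM x_root (horner_bounded q) wG.
apply: eventually_imp (eventually_and gw qF) => n [gn qn].
rewrite -(subrK g h) hg hornerD hornerM val_addr ?gn //.
by rewrite mulrC.
Qed.

(** Each axiom of a valuation holds for the eventual values because it holds for
    [nu0] at every [x_n], and finitely many eventual equalities hold at a common
    index. *)
Lemma limit_valuation : exists nu : valuation L G, extends nu0 nu /\
  forall g : {poly K}, horner_alg theta g != 0 ->
    eventually (fun n => nu0 g.[x n] = nu (horner_alg theta g)).
Proof.
have [V HV] := choice limit_spec.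
have V0 : V 0 = None by have [->] := HV 0.
have Vlim g : horner_alg theta g != 0 ->
    eventually (fun n => nu0 g.[x n] = V (horner_alg theta g)).
  by move=> gn0; have [_ /(_ gn0)[_]] := HV (horner_alg theta g); apply.
have Veq y : V y = None <-> y = 0.
  split=> [e|->]; last exact: V0.
  by apply/eqP/negPn/negP => y0; have [_ /(_ y0)[[w]]] := HV y; rewrite e.
have VM y z : V (y * z) = vadd (V y) (V z).
  have [->|y0] := eqVneq y 0; first by rewrite mul0r V0.
  have [->|z0] := eqVneq z 0; first by rewrite mulr0 V0; case: (V y).
  have [g yg] := gen y; have [h zh] := gen z; rewrite yg in y0; rewrite zh in z0.
  have gh : horner_alg theta (g * h) = y * z by rewrite rmorphM /= -yg -zh.
  have gh0 : horner_alg theta (g * h) != 0 by rewrite rmorphM mulf_neq0.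
  have [n [[e1 e2] e3]] := eventually_ex
    (eventually_and (eventually_and (Vlim _ y0) (Vlim _ z0)) (Vlim _ gh0)).
  by rewrite -gh -e3 yg -e1 zh -e2 hornerM valM.
have VD y z : vle (vmin (V y) (V z)) (V (y + z)).
  have [->|y0] := eqVneq y 0.
    by rewrite add0r V0 /vmin; case: (V z) => //= w; rewrite lexx.
  have [->|z0] := eqVneq z 0.
    by rewrite addr0 V0 /vmin; case: (V y) => //= w; rewrite lexx.
  have [yz0|yz0] := eqVneq (y + z) 0; first by rewrite yz0 V0; case: (vmin _ _).
  have [g yg] := gen y; have [h zh] := gen z; rewrite yg in y0; rewrite zh in z0.
  have gh : horner_alg theta (g + h) = y + z by rewrite rmorphD /= -yg -zh.
  rewrite -gh in yz0.
  have [n [[e1 e2] e3]] := eventually_ex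
    (eventually_and (eventually_and (Vlim _ y0) (Vlim _ z0)) (Vlim _ yz0)).
  by rewrite -gh -e3 yg -e1 zh -e2 hornerD val_leD.
exists (Valuation Veq VM VD); split=> [c|//] /=.
have [->|c0] := eqVneq c 0; first by rewrite scale0r V0 val0.
have cn0 : horner_alg theta c%:P != 0.
  by rewrite horner_algC scaler_eq0 negb_or c0 oner_neq0.
have [n] := eventually_ex (Vlim _ cn0).
by rewrite horner_algC hornerC.
Qed.

Lemma limit_unique (nu nu' : valuation L G) :
  extends nu0 nu -> extends nu0 nu' ->
  bounded nu0 nu (fun=> theta) -> bounded nu0 nu' (fun=> theta) ->
  null nu0 nu (fun n => theta - (x n)%:A) ->
  null nu0 nu' (fun n => theta - (x n)%:A) -> nu = nu'.
Proof.
suff lim mu : extends nu0 mu -> bounded nu0 mu (fun=> theta) ->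
    null nu0 mu (fun n => theta - (x n)%:A) -> forall g, ~~ (F %| g) ->
    eventually (fun n => mu (horner_alg theta g) = nu0 g.[x n]).
  move=> ext ext' b b' l l'; apply: valuationP => y; have [g ->] := gen y.
  have [Fg|ng] := boolP (F %| g).
    have /eqP -> : horner_alg theta g == 0 by rewrite (irreducible_root_dvdp _ irr).
    by rewrite !val0.
  have [n [-> ->]] := eventually_ex
    (eventually_and (lim nu ext b l g ng) (lim nu' ext' b' l' g ng)).
  by [].
move=> ext bd nl g ng; have [w wG gw] := horner_stable ng.
have ext' c : mu (in_alg L c) = nu0 c by exact: ext.
have bx : bounded nu0 mu (fun n => (x n)%:A).
  by have [c cG cx] := x_bounded; exists c => // n; rewrite ext.
have d := null_horner ext' g bd bx nl wG.
apply: eventually_imp (eventually_and gw d) => n [gn].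
rewrite -[(map_poly _ g).[theta]]/(horner_alg theta g).
rewrite -in_alg_horner => h.
rewrite -(subrK (g.[x n])%:A (horner_alg theta g)) val_addr ?ext //.
by rewrite gn.
Qed.

End LimitValuation.

(** * The split case *)

(** The elements bounded in absolute value by a multiple of [g] form a nonzero
    convex subgroup, which is the whole value group. *)
Lemma rank_one_archimedean (K : fieldType) (G : orderedAbType)
    (nu : valuation K G) g w : rank_one nu ->
  value_group nu g -> 0 < g -> value_group nu w -> exists n, w <= g *+ n.
Proof.
move=> [_ r1] gG g0 wG.
pose H := [set h | value_group nu h /\ exists n, h <= g *+ n /\ - h <= g *+ n].
have : convex_subgroup (value_group nu) H.
  split=> [|h [] //|k h kG [_ [n [hn _]]] /andP[k0 kh]].
    split; first by split; [exact: value_group0 | exists 0%N; rewrite mulr0n oppr0].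
    move=> h k [hG [n [hn hn']]] [kG [m [km km']]]; split; first exact: value_groupB.
    exists (n + m)%N; rewrite mulrnDr opprB; split; first exact: oab_leD.
    by rewrite addrC; exact: oab_leD.
  split=> //; exists n; split; first exact: le_trans hn.
  apply: (@le_trans _ _ 0); first by rewrite oab_leN0.
  exact: le_trans (le_trans k0 kh) hn.
have gH : H g.
  split=> //; exists 1%N; rewrite mulr1n; split=> //.
  by apply: (@le_trans _ _ 0); [rewrite oab_leN0|]; exact: ltW.
move=> /r1[H0|HG].
  by move: gH; rewrite H0 => /= g00; rewrite g00 ltxx in g0.
by move: wG; rewrite -HG => -[_ [n [wn _]]]; exists n.
Qed.

Section SplitCase.
Variables (K : fieldType) (L : fieldExtType K) (G : orderedAbType).
Variables (nu0 : valuation K G) (p : nat) (a : K) (theta : L).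
Hypotheses (pK : p \in [pchar K]) (rank1 : rank_one nu0).
Local Notation F := (artin_schreier p a).
Hypothesis irr : irreducible_poly F.
Hypothesis theta_root : horner_alg theta F = 0.
Hypothesis gen : forall x : L,
  exists2 g : {poly K}, (size g <= p)%N & x = horner_alg theta g.
Implicit Types nu : valuation L G.

Let p_pr : prime p := pcharf_prime pK.
Let p_gt1 : (1 < p)%N := prime_gt1 p_pr.
Let p_gt0 : (0 < p)%N := prime_gt0 p_pr.
Let pL : p \in [pchar L]. Proof. by rewrite pchar_lalg. Qed.

Lemma horner_add_artin_schreier y z : F.[y + z] = F.[y] + (z ^+ p - z).
Proof.
rewrite !horner_artin_schreier exprDp // opprD addrACA.
by rewrite [LHS]addrAC.
Qed.

Lemma artin_schreier_translate b j : F.[b + j%:R] = F.[b].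
Proof. by rewrite horner_add_artin_schreier natr_expp // subrr addr0. Qed.

Section Approximants.
Variable b : K.
Hypothesis Fb_gt0 : vlt (Some 0) (nu0 F.[b]).

(** The roots of [z^p - z + c] include the formal sum of the [c^(p^i)]; these are
    its partial sums, shifted by [b]. *)
Definition approximant n := b + \sum_(i < n) F.[b] ^+ (p ^ i).

Lemma horner_approximant n : F.[approximant n] = F.[b] ^+ (p ^ n).
Proof.
elim: n => [|n IH]; first by rewrite /approximant big_ord0 addr0 expn0 expr1.
rewrite /approximant big_ord_recr /= addrA horner_add_artin_schreier.
by rewrite -/(approximant n) IH -exprM -expnSr addrC subrK.
Qed.

Let pow_gt0 n : vlt (Some 0) (nu0 (F.[b] ^+ (p ^ n))).
Proof.
case E: (nu0 F.[b]) Fb_gt0 => [g|] /= g0; last first.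
  by move/val_eqoo: E => ->; rewrite expr0n expn_eq0 gtn_eqF ?val0.
by rewrite (valX _ E) /= -[X in X < _](mul0rn _ (p ^ n)) oab_ltMn // expn_gt0 p_gt0.
Qed.

Lemma approximant_sub n : vlt (Some 0) (nu0 (approximant n - b)).
Proof. by rewrite /approximant addrAC subrr add0r; apply: val_sum_lt => i _. Qed.

Lemma powers_null : null nu0 nu0 (fun n => F.[b] ^+ (p ^ n)).
Proof.
move=> w wG; case E: (nu0 F.[b]) Fb_gt0 => [g|] /= g0; last first.
  exists 0%N => n _; move/val_eqoo: E => ->.
  by rewrite expr0n expn_eq0 gtn_eqF ?val0.
have gG : value_group nu0 g by exists F.[b].
have [N wN] := rank_one_archimedean rank1 gG g0 wG.
exists N.+1 => n Nn; rewrite (valX _ E) /=.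
apply: le_lt_trans wN _; apply: (@lt_le_trans _ _ (g *+ N.+1)).
  by rewrite mulrSr -[X in X < _]addr0 ![g *+ N + _]addrC oab_ltD2.
apply: oab_leMn_exp (ltW g0) _; apply: leq_trans Nn _.
by apply: ltnW; apply: ltn_expl.
Qed.

Lemma approximant_bounded : bounded nu0 nu0 approximant.
Proof.
have id_val c : nu0 ((idfun : {rmorphism K -> K}) c) = nu0 c by [].
have sub_b : bounded nu0 nu0 (fun n => approximant n - b).
  by exists 0 => [|n]; [exact: value_group0 | exact/vltW/approximant_sub].
have [w wG h] := boundedD (bounded_cst id_val b) sub_b.
by exists w => // n; have := h n; rewrite /= subrKC.
Qed.

Lemma theta_bounded nu : extends nu0 nu -> vlt (Some 0) (nu (theta - b%:A)) ->
  bounded nu0 nu (fun=> theta).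
Proof.
move=> ext tb; have sub_b : bounded nu0 nu (fun=> theta - b%:A).
  by exists 0 => [|n]; [exact: value_group0 | exact/vltW].
have ext' c : nu (in_alg L c) = nu0 c by exact: ext.
have [w wG h] := boundedD (bounded_cst ext' b) sub_b.
by exists w => // n; have := h n; rewrite /= subrKC.
Qed.

(** The difference [theta - x_n] has positive value, hence the same value as
    [(theta - x_n)^p - (theta - x_n) = - F(x_n)]. *)
Lemma theta_null nu : extends nu0 nu -> vlt (Some 0) (nu (theta - b%:A)) ->
  null nu0 nu (fun n => theta - (approximant n)%:A).
Proof.
move=> ext tb w wG; apply: eventually_imp (powers_null wG) => n.
have pos : vlt (Some 0) (nu (theta - (approximant n)%:A)).
  have -> : theta - (approximant n)%:A = theta - b%:A - (approximant n - b)%:A.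
    by rewrite scalerBl opprB addrA subrK.
  by apply: val_ltadd; rewrite // valN ext approximant_sub.
rewrite -(val_artin_schreier_gt0 p_gt1 pos) (theta_sub pK theta_root).
by rewrite valN ext horner_approximant.
Qed.

Lemma split_extension : exists nu : valuation L G,
  [/\ extends nu0 nu, vlt (Some 0) (nu (theta - b%:A)) &
      forall nu', extends nu0 nu' -> vlt (Some 0) (nu' (theta - b%:A)) -> nu' = nu].
Proof.
have gen' (y : L) : exists g : {poly K}, y = horner_alg theta g.
  by have [g _ ->] := gen y; exists g.
have root_null : null nu0 nu0 (fun n => F.[approximant n]).
  by apply: eq_null powers_null => n; rewrite horner_approximant.
have cauchy : null nu0 nu0 (fun n => approximant n.+1 - approximant n).
  apply: eq_null powers_null => n.
  by rewrite /approximant big_ord_recr /= addrA [RHS]addrC addKr.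
have [nu [ext lim]] :=
  limit_valuation irr theta_root gen' approximant_bounded cauchy root_null.
have tb : vlt (Some 0) (nu (theta - b%:A)).
  have [->|t0] := eqVneq (theta - b%:A) 0; first by rewrite val0.
  have XbE : horner_alg theta ('X - b%:P) = theta - b%:A.
    by rewrite rmorphB /= horner_algX horner_algC.
  have [n] : exists n,
      nu0 ('X - b%:P).[approximant n] = nu (horner_alg theta ('X - b%:P)).
    by apply: eventually_ex; apply: lim; rewrite XbE.
  by rewrite XbE hornerXsubC => <-; exact: approximant_sub.
exists nu; split=> // nu' ext' tb'.
by apply: (limit_unique irr theta_root gen' approximant_bounded cauchy root_null);
  rewrite //; do [exact: theta_bounded | exact: theta_null].
Qed.

End Approximants.

(** The [j]-th extension is the one with [nu (theta - (b + j)) > 0].  Every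
    extension occurs because the product over [j < p] of the
    [theta - (b + j)] is [- F(b)].  If the [i]-th and [j]-th extensions agree,
    then [j - i] has positive value; as [z^p - z] and [z] have the same value for
    such a [z], and [z^p - z = 0] here, [j - i] vanishes in [K]. *)
Lemma split_card b : vlt (Some 0) (nu0 F.[b]) ->
  ([set nu : valuation L G | extends nu0 nu] #= `I_p)%card.
Proof.
move=> b0; have b0j j : vlt (Some 0) (nu0 F.[b + j%:R]) by rewrite artin_schreier_translate.
have [N HN] := choice (fun j : nat => split_extension (b0j j)).
have -> : [set nu : valuation L G | extends nu0 nu] = N @` `I_p.
  apply/seteqP; split=> [nu ext|_ [j _ <-]] /=; last by have [] := HN j.
  have [j [jp tj]] : exists j, (j < p)%N /\ vlt (Some 0) (nu (theta - (b + j%:R)%:A)).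
    apply: contrapT => /forallNP none.
    pose y := theta - b%:A.
    have prodE : \prod_(r <- [seq 0 + j%:R | j <- iota 0 p]) (y - r) = - (F.[b])%:A.
      rewrite -(theta_sub pK theta_root) -/y.
      have := artin_schreier_prod pL 0; rewrite expr0n gtn_eqF // subr0.
      move=> /(congr1 (fun f : {poly L} => f.[y])) /=.
      rewrite horner_artin_schreier subr0 => ->; rewrite horner_prod.
      by apply: eq_bigr => r _; rewrite hornerXsubC.
    have : vle (nu (\prod_(r <- [seq 0 + j%:R | j <- iota 0 p]) (y - r))) (Some 0).
      rewrite big_seq; apply: (big_ind (fun z => vle (nu z) (Some 0))).
      - by rewrite val1 vle_refl.
      - by move=> u v u0 v0; rewrite valM; move: (vle_add u0 v0); rewrite /= addr0.
      move=> r /mapP[j]; rewrite mem_iota add0n add0r => jp ->.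
      have /not_andP[//|/negP] := none j; rewrite -vleNgt scalerDl opprD addrA.
      by rewrite scaler_nat.
    by rewrite prodE valN ext vleNgt b0.
  by exists j => //; have [_ _ u] := HN j; rewrite (u nu).
apply: inj_card_eq => i j /set_mem /= ip /set_mem /= jp eN.
have [ext ti _] := HN i; have [_ tj _] := HN j; rewrite -eN in tj.
have z0 : vlt (Some 0) (nu0 (j%:R - i%:R)).
  rewrite -ext (_ : _%:A = (theta - (b + i%:R)%:A) - (theta - (b + j%:R)%:A)).
    by apply: val_ltadd; rewrite ?valN.
  rewrite opprB [RHS]addrC addrA subrK -scalerBl; congr (_ *: _).
  by rewrite opprD addrACA subrr add0r.
apply: esym; apply: (natr_inj_ltp pK) => //; apply/eqP; rewrite -subr_eq0; apply/eqP.
apply/(val_eqoo nu0); rewrite -(val_artin_schreier_gt0 p_gt1 z0).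
by rewrite exprBp // !natr_expp // subrr val0.
Qed.

End SplitCase.

(** * Uniqueness when no value of F is positive *)

Section NonpositiveCase.
Variables (K : fieldType) (L : fieldExtType K) (G : orderedAbType).
Variables (nu0 : valuation K G) (p : nat) (a : K) (theta : L).
Hypotheses (divG : divisible G) (pK : p \in [pchar K]).
Local Notation F := (artin_schreier p a).
Local Notation Gamma0 := (value_group nu0).
Hypothesis theta_root : horner_alg theta F = 0.
Hypothesis gen : forall x : L,
  exists2 g : {poly K}, (size g <= p)%N & x = horner_alg theta g.
Hypothesis nonpos : forall b, vle (nu0 F.[b]) (Some 0).

Let p_pr : prime p := pcharf_prime pK.
Let p_gt1 : (1 < p)%N := prime_gt1 p_pr.
Let p_gt0 : (0 < p)%N := prime_gt0 p_pr.

Definition value_set : set G := [set s | exists b : K, nu0 F.[b] = Some (s *+ p)].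

Lemma value_set_le0 s : value_set s -> s <= 0.
Proof.
move=> [b e]; have := nonpos b.
by rewrite e /= -[X in _ <= X](mul0rn _ p) oab_leMnE.
Qed.

Lemma value_set_exists b : exists s, nu0 F.[b] = Some (s *+ p).
Proof.
have := nonpos b; case: (nu0 F.[b]) => [g|] // _.
by have [s sg] := divG g p_gt0; exists s; rewrite sg.
Qed.

(** The distance from [theta] to [b]. *)
Definition root_distance := projT1 (choice value_set_exists).

Lemma val_root_distance b : nu0 F.[b] = Some (root_distance b *+ p).
Proof. exact: (projT2 (choice value_set_exists)). Qed.

Lemma val_theta_root_distance (nu : valuation L G) : extends nu0 nu ->
  forall b, nu (theta - b%:A) = Some (root_distance b).
Proof.
move=> ext b; apply: (val_theta_sub pK theta_root ext _ (val_root_distance b)).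
by apply: value_set_le0; exists b; exact: val_root_distance.
Qed.

Let attains_max := exists2 m, value_set m & forall s, value_set s -> s <= m.

Lemma root_distance_no_max : ~ attains_max ->
  forall b, exists b', root_distance b < root_distance b'.
Proof.
move=> nomax b; apply: contrapT => /forallNP none; apply: nomax.
exists (root_distance b); first by exists b; exact: val_root_distance.
move=> s [b' e]; move: (val_root_distance b'); rewrite e => -[/(oab_mulIn p_gt0) ->].
by have /negP := none b'; rewrite oab_ltNge negbK.
Qed.

Lemma max_witness : value_set `<=` Gamma0 -> attains_max ->
  exists b d m, [/\ m <= 0, nu0 F.[b] = Some (m *+ p), nu0 d = Some m, m = 0 -> d = 1
    & forall b', vle (nu0 F.[b']) (Some (m *+ p))].
Proof.
move=> SG [m Sm max]; have [b bm] := Sm; have [d0 d0m] := SG m Sm.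
exists b, (if m == 0 then 1 else d0), m; split=> //.
- exact: value_set_le0.
- by case: eqP => // ->; rewrite val1.
- by move=> ->; rewrite eqxx.
move=> b'; rewrite val_root_distance /= oab_leMn // max //.
by exists b'; exact: val_root_distance.
Qed.

Lemma nonpositive_uniq (nu nu' : valuation L G) :
  extends nu0 nu -> extends nu0 nu' -> nu = nu'.
Proof.
move=> ext ext'.
have [SG|] := pselect (value_set `<=` Gamma0); last first.
  move=> /existsNP[s /not_implyP[[b e] ns]].
  have s0 : s <= 0 by apply: value_set_le0; exists b.
  apply: (monomial_val_uniq (gen_affine gen b (oner_neq0 K))).
    exact: (ramified_monomial pK theta_root s0 e ns ext).
  exact: (ramified_monomial pK theta_root s0 e ns ext').
have [/(max_witness SG)[b [d [m [m0 e dm d1 max]]]]|nomax] := pselect attains_max.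
  apply: (monomial_val_uniq (gen_affine gen b (val_neq0 dm))).
    exact: (inert_monomial divG pK theta_root m0 e dm d1 max ext).
  exact: (inert_monomial divG pK theta_root m0 e dm d1 max ext').
apply: (immediate_uniq ext ext' pK gen (root_distance_no_max nomax)) val_root_distance.
  exact: val_theta_root_distance.
exact: val_theta_root_distance.
Qed.

End NonpositiveCase.

(** * The generator of K[X]/(F) *)

Section Quotient.
Variables (K : fieldType) (p : nat) (pK : p \in [pchar K]) (a : K).
Local Notation F := (artin_schreier p a).
Variable irr : irreducible_poly F.
Let L := artin_schreier_ext pK irr.
Let theta : L := in_qpoly F 'X.

Lemma horner_alg_quotient (g : {poly K}) : horner_alg theta g = in_qpoly F g :> L.
Proof.
rewrite -[in RHS](comp_polyXr g) in_qpoly_comp_horner.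
rewrite /horner_alg /horner_morph; congr (_.[_]).
apply: eq_map_poly => c /=; apply: val_inj => /=.
by rewrite -mul_polyC mulr1.
Qed.

Let monF : mk_monic F = F.
Proof. exact: (mk_monicE (artin_schreier_mi pK irr)). Qed.

Lemma quotient_root : horner_alg theta F = 0.
Proof.
rewrite horner_alg_quotient; apply: val_inj => /=.
by rewrite monF Pdiv.RingMonic.rmodpp ?artin_schreier_monic.
Qed.

Lemma quotient_gen (x : L) :
  exists2 g : {poly K}, (size g <= p)%N & x = horner_alg theta g.
Proof.
have x_lt : (size (val x) < size (mk_monic F))%N by exact: size_mk_monic.
exists (val x).
  by rewrite -ltnS; apply: leq_trans x_lt _; rewrite monF size_artin_schreier.
rewrite horner_alg_quotient; apply: val_inj; symmetry; exact: in_qpoly_small.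
Qed.

Lemma quotient_dim : \dim {:L} = p.
Proof.
rewrite [LHS]dim_polyn.
by rewrite monF size_artin_schreier.
Qed.

End Quotient.

Theorem theorem1p6 (G : orderedAbType) (divG : divisible G)
    (K : fieldType) (p : nat) (pK : p \in [pchar K])
    (nu0 : valuation K G) (a : K)
    (irr : irreducible_poly (artin_schreier p a))
    (rank1 : rank_one nu0) :
  let F := artin_schreier p a in
  let L := artin_schreier_ext pK irr in
  ((exists b : K, vlt (Some 0) (nu0 F.[b])) <->
     ([set nu : valuation L G | extends nu0 nu] #= `I_p)%card)
  /\
  ((forall b : K, vle (nu0 F.[b]) (Some 0)) ->
   let S : set G := [set s | exists b : K, nu0 F.[b] = Some (s *+ p)] in
   forall nu : valuation L G, extends nu0 nu ->
   let e := ramification_index nu0 nu in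
   let f := inertia_degree nu0 nu in
   [/\ ~ (S `<=` value_group nu0) -> e = p,
       S `<=` value_group nu0 ->
         (exists2 m, S m & forall s, S s -> s <= m) -> f = p
     & S `<=` value_group nu0 ->
         ~ (exists2 m, S m & forall s, S s -> s <= m) ->
         [/\ forall nu' : valuation L G, extends nu0 nu' -> nu' = nu,
             e = 1%N, f = 1%N
           & (\dim {:L})%:R / (e * f)%:R = p%:R :> rat]]).

Proof.
move=> F L.
have root := quotient_root pK irr; have gen := @quotient_gen _ _ pK _ irr.
have p_gt1 : (1 < p)%N by rewrite prime_gt1 ?(pcharf_prime pK).
split.
  split=> [[b b_gt0]|card_p]; first exact: (split_card pK rank1 irr root gen b_gt0).
  apply: contrapT => /forallNP none.
  have nonpos b : vle (nu0 F.[b]) (Some 0) by rewrite vleNgt; exact/negP/none.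
  have uniq := nonpositive_uniq divG pK root gen nonpos.
  have /card_set_bijP[f [_ _ surj]] := card_p.
  have [nu ext nu0E] := surj 0%N (ltnW p_gt1).
  have [nu' ext' nu1E] := surj 1%N p_gt1.
  by move: nu1E; rewrite -(uniq _ _ ext ext') nu0E.
move=> nonpos S nu ext e f; split.
- move=> /existsNP[s /not_implyP[[b sb] ns]].
  apply: (ramified_index pK root gen _ sb ns ext).
  by apply: (value_set_le0 pK nonpos); exists b.
- move=> SG /(max_witness divG pK nonpos SG)[b [d [m [m0 sb dm d1 max]]]].
  exact: (inert_degree divG pK root gen m0 sb dm d1 max ext).
move=> SG nomax.
have theta_gamma := val_theta_root_distance divG pK root nonpos ext.
have vF := val_root_distance divG pK nonpos.
have nm := root_distance_no_max divG pK nonpos nomax.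
have e1 : e = 1%N.
  exact: (immediate_ramification ext pK gen nm theta_gamma vF).
have f1 : f = 1%N.
  exact: (immediate_inertia ext pK gen nm theta_gamma vF).
split=> //; first by move=> nu' ext'; exact: (nonpositive_uniq divG pK root gen nonpos).
by rewrite e1 f1 quotient_dim muln1 divr1.
Qed.
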